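(* The incidence structure $\bm{S}=(\mathcal{P},\mathcal{L})$ defined in the context (constructed from the 3-dimensional unitary geometry $(V,h)$ over $\mathbb{F}_4$ and the hyperovals $H_0,\tilde{H}_0$) is the $G_2(2)$-hexagon; that is, $\bm{S}$ is a generalized hexagon of order $(2,2)$ isomorphic to the split Cayley hexagon of order $2$.
   Context: **Unitary geometry.** Let $\mathbb{F}_4=\mathbb{F}_2[\omega]$ with $\omega^2+\omega+1=0$ and $\bar{\alpha}=\alpha^2$. Let $V$ be a 3-dimensional vector space over $\mathbb{F}_4$ with a non-degenerate Hermitian form $h$ (sesquilinear, $h(y,x)=\overline{h(x,y)}$). Put $V_0=\{x\in V\setminus\{0\}\mid h(x,x)=0\}$ (27 vectors) and $V_1=\{x\in V\mid h(x,x)=1\}$ (36 vectors). For $0\neq x\in V$, $[x]$ denotes the point of the projective plane $PG(V)$ spanned by $x$, identified with the set $\{x,\omega x,\bar{\omega}x\}$ of its nonzero vectors. The plane has 9 isotropic points ($[x]$ with $x\in V_0$) and 12 non-isotropic points ($[x]$ with $x\in V_1$). A hyperoval of $PG(V)$ is a set of 6 projective points meeting every projective line in 0 or 2 points. Let $H_0$ be a hyperoval of $PG(V)$ all of whose points are non-isotropic, and let $\tilde{H}_0$ be the set of the 6 remaining non-isotropic points. Put $W=\{x\in V_1\mid [x]\in H_0\}$ and $\tilde{W}=\{x\in V_1\mid [x]\in\tilde{H}_0\}$; each has 18 vectors, and $V_1$ is the disjoint union of $W$ and $\tilde{W}$. **The structure $\bm{S}$.** The point set is $\mathcal{P}=V\setminus\{0\}$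 (63 points), and the line set $\mathcal{L}$ consists of the following subsets of $\mathcal{P}$, for all $a\in V_0$: (i) $[a]=\{a,\omega a,\bar{\omega}a\}$; (ii) $L(a)=\{x\in W\mid h(a,x)=0 \text{ and } a+x\in W\}\cup\{a\}$; (iii) $\tilde{L}(a)=\{x\in\tilde{W}\mid h(a,x)=0 \text{ and } a+x\in\tilde{W}\}\cup\{a\}$. Incidence is membership. **Generalized hexagons.** A partial linear space of order $(s,t)$ is a pair $(\mathcal{P},\mathcal{L})$, where $\mathcal{L}$ is a set of $(s+1)$-subsets (lines) of the set $\mathcal{P}$ of points, such that each point is in exactly $t+1$ lines and any two distinct points are in at most one common line. It is a generalized hexagon of order $(s,t)$ if its incidence graph (vertex set $\mathcal{P}\cup\mathcal{L}$, edges $\{p,l\}$ with $p\in l$) has diameter 6 and girth 12. An isomorphism between two such structures is a bijection from points to points and from lines to lines which preserves incidence in both directions. **The split Cayley hexagon of order 2** (the $G_2(2)$-hexagon) is the following structure in its standard (Tits) description. Its points are all 63 points of the quadric $Q(6,2)$ in $PG(6,2)$ with equation $X_0X_4+X_1X_5+X_2X_6=X_3^2$. Its lines are the projective lines contained in $Q(6,2)$ whose Grassmann coordinates $p_{ij}=x_iy_j+x_jy_i$ (for a line through distinct points $(x_0,\dots,x_6)$ and $(y_0,\dots,y_6)$) satisfy $p_{12}=p_{34}$, $p_{45}=p_{23}$, $p_{02}=p_{35}$, $p_{56}=p_{03}$, $p_{01}=p_{36}$, $p_{46}=p_{13}$. *)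

(* Defs.v *)
From HB Require Import structures.
From mathcomp Require Import all_boot all_order all_algebra all_field.

Set Implicit Arguments.
Unset Strict Implicit.
Unset Printing Implicit Defensive.

Import GRing.Theory.
Local Open Scope ring_scope.

(* Graphs: an adjacency relation [e] on a type of candidate vertices, together
   with the predicate [D] selecting the actual vertices. *)
Section Graph.
Variables (U : eqType) (D : {pred U}) (e : rel U).

Definition walk (k : nat) (u v : U) : Prop :=
  exists c : seq U, [/\ path e u c, last u c = v & size c = k].

Definition distance (u v : U) (k : nat) : Prop :=
  walk k u v /\ forall j, (j < k)%N -> ~ walk j u v.

Definition diameter (d : nat) : Prop :=
  (forall u v, u \in D -> v \in D -> exists2 k, (k <= d)%N & distance u v k)
  /\ (exists u v, [/\ u \in D, v \in D & distance u v d]).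

(* [2 < size c] discards the degenerate closed walks [:: u; v]. *)
Definition graph_cycle (c : seq U) : Prop :=
  [/\ all [in D] c, ucycle e c & (2 < size c)%N].

Definition girth (g : nat) : Prop :=
  (exists2 c, graph_cycle c & size c = g)
  /\ (forall c, graph_cycle c -> (g <= size c)%N).

End Graph.

Section Geometry.
Variables (T : finType) (P : {set T}) (L : {set {set T}}).

Definition partial_linear_space (s t : nat) : Prop :=
  [/\ forall l, l \in L -> l \subset P /\ #|l| = s.+1,
      forall p, p \in P -> #|[set l in L | p \in l]| = t.+1
    & forall p q, p \in P -> q \in P -> p != q ->
        (#|[set l in L | (p \in l) && (q \in l)]| <= 1)%N].

Definition inc_vertex : {pred T + {set T}} :=
  fun u => match u with inl p => p \in P | inr l => l \in L end.

Definition inc_edge : rel (T + {set T}) :=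
  fun u v => match u, v with
  | inl p, inr l => [&& p \in P, l \in L & p \in l]
  | inr l, inl p => [&& p \in P, l \in L & p \in l]
  | _, _ => false
  end.

Definition generalized_hexagon (s t : nat) : Prop :=
  [/\ partial_linear_space s t,
      diameter inc_vertex inc_edge 6
    & girth inc_vertex inc_edge 12].

End Geometry.

Definition geometry_isomorphic (T T' : finType)
    (P : {set T}) (L : {set {set T}}) (P' : {set T'}) (L' : {set {set T'}}) :
    Prop :=
  exists (f : T -> T') (g : {set T} -> {set T'}),
  [/\ {in P &, injective f} /\ f @: P = P',
      {in L &, injective g} /\ g @: L = L'
    & {in P & L, forall p l, (f p \in g l) = (p \in l)}].

(* [finvect_type V] is [V] itself with its finType structure; subsets of a
   finite vector space [V] live in [{set finvect_type V}]. *)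
Section UnitaryGeometry.
Variables (F : finFieldType) (w : F) (V : vectType F) (conj : F -> F).
Variable h : {hermitian_sym V for conj}.
Local Notation fV := (finvect_type V).

Definition pg_point (x : fV) : {set fV} := [set x; w *: x; (w ^+ 2) *: x].

Definition V0 : {set fV} := [set x : fV | (x != 0) && (h x x == 0)].
Definition V1 : {set fV} := [set x : fV | h x x == 1].

Definition noniso_points : {set {set fV}} := [set pg_point x | x in V1].

(* The lines of PG(V) are the 2-dimensional subspaces of V. *)
Definition hyperoval (H : {set {set fV}}) : Prop :=
  [/\ forall p, p \in H -> exists2 x : fV, x != 0 & p = pg_point x,
      #|H| = 6%N
    & forall U : {vspace V}, \dim U = 2%N ->
        let k := #|[set p in H | [forall x in p, (x : V) \in U]]| in
        k = 0%N \/ k = 2%N].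

Definition vectors_over (H : {set {set fV}}) : {set fV} :=
  [set x in V1 | pg_point x \in H].

Definition hline (W : {set fV}) (a : fV) : {set fV} :=
  [set x in W | (h a x == 0) && (a + x \in W)] :|: [set a].

Definition S_points : {set fV} := [set x : fV | x != 0].

Definition S_lines (H0 : {set {set fV}}) : {set {set fV}} :=
  let W := vectors_over H0 in
  let W' := vectors_over (noniso_points :\: H0) in
  [set pg_point a | a in V0] :|: [set hline W a | a in V0]
    :|: [set hline W' a | a in V0].

End UnitaryGeometry.

(* Over F_2 a point of PG(6,2) is the same thing as a nonzero vector of F_2^7,
   and the line through two points x, y is {x, y, x + y}. *)
Section SplitCayley.
Local Notation vec := 'rV['F_2]_7.

Definition crd (x : vec) (i : nat) : 'F_2 := x ord0 (inZp i).

Definition Q62 : {set vec} :=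
  [set x : vec | (x != 0) &&
    (crd x 0 * crd x 4 + crd x 1 * crd x 5 + crd x 2 * crd x 6
       == crd x 3 ^+ 2)].

Definition grassmann (x y : vec) (i j : nat) : 'F_2 :=
  crd x i * crd y j + crd x j * crd y i.

Definition tits_line (x y : vec) : bool :=
  let p := grassmann x y in
  [&& p 1%N 2%N == p 3%N 4%N, p 4%N 5%N == p 2%N 3%N,
      p 0%N 2%N == p 3%N 5%N, p 5%N 6%N == p 0%N 3%N,
      p 0%N 1%N == p 3%N 6%N & p 4%N 6%N == p 1%N 3%N].

Definition pg62_line (x y : vec) : {set vec} := [set x; y; x + y].

Definition split_cayley_lines : {set {set vec}} :=
  [set l : {set vec} | [exists x : vec, exists y : vec,
     [&& x != 0, y != 0, x != y, l == pg62_line x y, l \subset Q62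
       & tits_line x y]]].

End SplitCayley.

(* Main.v *)
Require Import Defs.
From HB Require Import structures.
From mathcomp Require Import all_boot all_order all_algebra all_field.
From mathcomp Require Import ring.

Set Implicit Arguments.
Unset Strict Implicit.
Unset Printing Implicit Defensive.

Import GRing.Theory.
Local Open Scope ring_scope.

(** Every line of S is a triple {x, y, x + y} of nonzero vectors: w^2 a = a + w a
on the line [a], and the third point of L(a) is a + x.  Hence S is encoded by
its collinearity relation on V, seen as a space of dimension 6 over F_2 that
carries the symplectic form Tr h(x, y).  The proof has three parts.

The shape of H0.  Let p and q be orthogonal non-isotropic points.  The line pq
contains no further non-isotropic point, and it meets H0 in 0 or 2 points, so
that H0 contains both p and q or neither ([hyperoval_orthogonal]).  The 12
non-isotropic points form four orthogonal triangles, so H0 is the union of two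
of these.  Take an orthonormal basis from the first triangle, scaled so that
e1 + e2 + e3 lies on the second one ([exists_adapted_frame]).  In the resulting
coordinates W consists of the unit vectors whose coordinates have product 0 or
1, and the other unit vectors, with product w or w^2, make up the complementary
set ([mem_hyperoval_vec]).  So S is isomorphic to one explicit geometry on
F_4^3, whatever V, h and H0 are ([S_lines_col]).

The hexagon property.  The three lines on a point p fill a plane of PG(5, 2)
which is totally isotropic, and maximal with this property.  Consider a polygon
with at most 5 vertices in S.  Any two of its vertices are equal, collinear or
collinear with a third one, so they are perpendicular; by maximality of the
planes they are collinear, which is absurd because S has no triangles
([no_shortcut]).  Thus the incidence graph has girth at least 12.  On the other
hand perpendicular points are at distance at most 4 in that graph, and by
linearity every line contains a point perpendicular to a given one; this bounds
the diameter by 6.  See [pencils_generalized_hexagon].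

The isomorphism.  Projection from the nucleus (0,0,0,1,0,0,0) maps the points of
Q(6,2) bijectively onto those of PG(5, 2).  So an F_2-linear isometry from V to
the coordinates X0, X1, X2, X4, X5, X6 gives, with X3 = X0X4 + X1X5 + X2X6, a
bijection from the points of S to those of the quadric.  The isometry
[cayley_coords] is chosen to respect collinearity ([col4_cayley]).

The properties of the explicit geometry on F_4^3 are finite statements about its
64 vectors, and they are decided by evaluation. *)

(** * Bounded distance in a graph *)

Section Walks.
Variables (U : eqType) (e : rel U).

Definition within (d : nat) (u v : U) : Prop :=
  exists2 k, (k <= d)%N & walk e k u v.

Lemma within_refl d u : within d u u.
Proof. by exists 0%N => //; exists [::]. Qed.

Lemma within_edge u v : e u v -> within 1 u v.
Proof. by move=> euv; exists 1%N => //; exists [:: v]; rewrite /= euv. Qed.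

Lemma within_trans d d' v u w :
  within d u v -> within d' v w -> within (d + d') u w.
Proof.
move=> [k lekd [c [ec lc sc]]]; subst k.
move=> [k' lekd' [c' [ec' lc' sc']]]; subst k'.
exists (size (c ++ c')); last first.
  by exists (c ++ c'); rewrite cat_path last_cat lc ec ec' lc'.
by rewrite size_cat leq_add.
Qed.

Lemma within_leq d d' u v : (d <= d')%N -> within d u v -> within d' u v.
Proof. by move=> led [k lekd wk]; exists k => //; apply: leq_trans led. Qed.

Lemma within_sym : symmetric e -> forall d u v, within d u v -> within d v u.
Proof.
move=> esym d u v [k lekd [c [ec lc sc]]]; subst k; exists (size c) => //.
exists (rev (belast u c)); split; last by rewrite size_rev size_belast.
  by rewrite -lc rev_path (eq_path (e' := e)) // => x y; rewrite esym.
by case: c lc {ec lekd} => //= v' c _; rewrite rev_cons last_rcons.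
Qed.

End Walks.

Lemma within_distance (U : finType) (e : rel U) d u v :
  within e d u v -> exists2 k, (k <= d)%N & distance e u v k.
Proof.
pose r k := [exists c : k.-tuple U, path e u c && (last u c == v)].
have rP k : reflect (walk e k u v) (r k).
  apply: (iffP existsP) => [[c /andP[ec /eqP lc]] | [c [ec lc sc]]].
    by exists c; rewrite size_tuple.
  by exists (Tuple (introT eqP sc)); rewrite /= ec lc eqxx.
case=> k lekd /rP rk; have exr : exists k, r k by exists k.
case: (ex_minnP exr) => j /rP rj minj; exists j.
  exact: leq_trans (minj _ rk) lekd.
by split=> // i ltij /rP/minj; rewrite leqNgt ltij.
Qed.

(** * Generalized hexagons from planar pencils of isotropic lines *)
Section FlatPencils.
Variables (T : finZmodType) (perp col : rel T).

Definition line (x y : T) : {set T} := [set x; y; x + y].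
Definition nonzero_points : {set T} := [set x | x != 0].
Definition lines : {set {set T}} :=
  [set l | [exists x, exists y, col x y && (l == line x y)]].

(** [perp] is orthogonality for a symplectic form over F_2.  The lines on a point
fill a totally isotropic plane, by [pencil] and [col_coplanar], and
[pencil_maximal] says that no larger totally isotropic subspace contains it. *)
Record hexagonal_pencils : Prop := HexagonalPencils {
  addvv : forall x : T, x + x = 0;
  perp_sym : symmetric perp;
  perpxx : reflexive perp;
  perpD : forall x y z, perp x (y + z) = (perp x y == perp x z);
  col_sym : symmetric col;
  col_neq : forall x y, col x y -> [&& x != 0, y != 0 & x != y];
  col_third : forall x y, col x y -> col x (x + y);
  col_coplanar : forall p x y, col p x -> col p y -> perp x y;
  pencil : forall p, p != 0 -> exists x y z,
    [/\ [&& col p x, col p y & col p z],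
        [&& y \notin line p x, z \notin line p x & z \notin line p y]
      & forall q, col p q -> [|| q \in line p x, q \in line p y | q \in line p z]];
  pencil_maximal : forall p x y z, col p x -> col p y -> y \notin line p x ->
    z != 0 -> perp z p -> perp z x -> perp z y -> (z == p) || col p z;
  no_triangle : forall x y z, col x y -> col y z -> col x z -> z \in line x y;
  perp_connected : forall x z, x != 0 -> z != 0 -> perp x z ->
    exists2 y, (x == y) || col x y & (y == z) || col y z;
  ordinary_hexagon : exists p0 p1 p2 p3 p4 p5,
    [/\ uniq [:: p0; p1; p2; p3; p4; p5],
        cycle col [:: p0; p1; p2; p3; p4; p5]
      & [&& p2 \notin line p0 p1, p3 \notin line p1 p2, p4 \notin line p2 p3,
            p5 \notin line p3 p4, p0 \notin line p4 p5 & p1 \notin line p5 p0]];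
  non_perp : exists x z, [/\ x != 0, z != 0 & ~~ perp x z]
}.

Hypothesis HP : hexagonal_pencils.
Local Notation P := nonzero_points.
Local Notation L := lines.
Local Notation e := (inc_edge P L).

Lemma in_line x y z : (z \in line x y) = [|| z == x, z == y | z == x + y].
Proof. by rewrite !inE orbA. Qed.

Lemma addvK (x y : T) : x + (x + y) = y.
Proof. by rewrite addrA (addvv HP) add0r. Qed.

Lemma line_sym x y : line x y = line y x.
Proof. by apply/setP => z; rewrite !in_line addrC orbCA. Qed.

Lemma line_third x y : line x (x + y) = line x y.
Proof. by apply/setP=> z; rewrite !in_line addvK (orbC (z == y)). Qed.

Lemma linesP l : reflect (exists x y, col x y /\ l = line x y) (l \in L).
Proof.
rewrite inE; apply: (iffP existsP) => [[x /existsP[y /andP[cxy /eqP->]]]|].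
  by exists x, y.
by case=> x [y [cxy ->]]; exists x; apply/existsP; exists y; rewrite cxy eqxx.
Qed.

Lemma col_line x y : col x y -> line x y \in L.
Proof. by move=> cxy; apply/linesP; exists x, y. Qed.

Lemma line_through l p q : l \in L -> p \in l -> q \in l -> p != q ->
  col p q /\ l = line p q.
Proof.
case/linesP=> x [y [cxy ->]]; rewrite !in_line.
have cyx : col y x by rewrite (col_sym HP).
have cx := col_third HP cxy; have := col_third HP cyx.
rewrite (addrC y) => cy.
have lx := line_third x y; have := line_third y x; rewrite (addrC y) => ly.
have [c1 c2] : col (x + y) x /\ col (x + y) y by rewrite !(col_sym HP (x + y)).
by case/or3P => /eqP-> /or3P[] /eqP->; rewrite ?eqxx // => _; split=> //;
   rewrite ?(line_sym (x + y)) ?lx ?ly // line_sym.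
Qed.

Lemma edgeP p l : reflect [/\ p != 0, l \in L & p \in l] (e (inl p) (inr l)).
Proof. by rewrite /= [p \in P]inE; apply: and3P. Qed.

Lemma inc_edge_sym : symmetric e.
Proof. by case=> [p|l] [q|m]. Qed.

Lemma mem_lines_neq0 l p : l \in L -> p \in l -> p != 0.
Proof.
case/linesP=> x [y [cxy ->]]; have /and3P[x0 y0 neq] := col_neq HP cxy.
rewrite in_line => /or3P[] /eqP-> //.
by apply: contra neq => /eqP xy0; rewrite -(addvK x y) xy0 addr0.
Qed.

Lemma edge_mem p l : l \in L -> p \in l -> e (inl p) (inr l).
Proof. by move=> lL pl; apply/edgeP; rewrite (mem_lines_neq0 lL). Qed.

Definition near p q := (p == q) || col p q.

Lemma near_within p q : near p q -> within e 2 (inl p) (inl q).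
Proof.
case/orP=> [/eqP->|cpq]; first exact: within_refl.
have ll := col_line cpq.
apply: (within_trans (d := 1) (d' := 1) (v := inr (line p q))).
  by apply: within_edge; apply: edge_mem => //; rewrite in_line eqxx.
apply: within_edge; rewrite inc_edge_sym; apply: edge_mem => //.
by rewrite in_line eqxx orbT.
Qed.

Lemma perp_within x z : x != 0 -> z != 0 -> perp x z -> within e 4 (inl x) (inl z).
Proof.
move=> x0 z0 pxz; have [y nxy nyz] := perp_connected HP x0 z0 pxz.
exact: within_trans (near_within nxy) (near_within nyz).
Qed.

(** A symplectic form that is nonzero at y and at z vanishes at y + z, so every
line has a point perpendicular to x. *)
Lemma point_line_within x l : x != 0 -> l \in L -> within e 5 (inl x) (inr l).
Proof.
move=> x0 lL; have [y yl pxy] : exists2 y, y \in l & perp x y.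
  case/linesP: lL => y [z [cyz ->]].
  case pxy: (perp x y); first by exists y; rewrite // in_line eqxx.
  case pxz: (perp x z); first by exists z; rewrite // in_line eqxx orbT.
  by exists (y + z); rewrite ?(perpD HP) ?pxy ?pxz // in_line eqxx !orbT.
apply: (within_trans (d := 4) (d' := 1)).
  exact: perp_within x0 (mem_lines_neq0 lL yl) pxy.
exact/within_edge/edge_mem.
Qed.

Lemma point_on_line l : l \in L -> exists2 p, p != 0 & p \in l.
Proof.
by case/linesP=> x [y [/(col_neq HP)/and3P[x0 _ _] ->]]; exists x; rewrite ?inE ?eqxx.
Qed.

Lemma line_on_point p : p != 0 -> exists2 l, l \in L & p \in l.
Proof.
move=> p0; have [x [y [z [/and3P[cx _ _] _ _]]]] := pencil HP p0.
by exists (line p x); rewrite ?col_line // in_line eqxx.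
Qed.

Lemma inc_within u v :
  u \in inc_vertex P L -> v \in inc_vertex P L -> within e 6 u v.
Proof.
have ll l v' : l \in L -> v' \in inc_vertex P L -> within e 6 (inr l) v'.
  move=> lL; case: v' => [q | m].
    move=> q0; apply: (@within_leq _ _ 5) => //.
    apply: within_sym; first exact: inc_edge_sym.
    by apply: point_line_within => //; rewrite -topredE /= inE in q0.
  rewrite -topredE /= => mL.
  have [p p0 pl] := point_on_line lL.
  apply: (within_trans (d := 1) (d' := 5) (v := inl p)).
    by apply: within_edge; rewrite inc_edge_sym; apply: edge_mem.
  exact: point_line_within.
case: u v => [p|l] [q|m]; last 2 first.
- exact: ll.
- exact: ll.
- rewrite -!topredE /= !inE => p0 q0.
  have [l lL ql] := line_on_point q0.
  apply: (within_trans (d := 5) (d' := 1) (v := inr l)).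
    exact: point_line_within.
  by apply: within_edge; rewrite inc_edge_sym; apply: edge_mem.
rewrite -!topredE /= inE => p0 mL; apply: (@within_leq _ _ 5) => //.
exact: point_line_within.
Qed.

Lemma edge_near p l q : e (inl p) (inr l) -> e (inr l) (inl q) -> near p q.
Proof.
rewrite (inc_edge_sym (inr l)) => /edgeP[_ lL pl] /edgeP[_ _ ql].
rewrite /near; case: eqP => // /eqP npq.
by have [->] := line_through lL pl ql npq.
Qed.

(** Both q and p + q are collinear with p, hence perpendicular to each other, and
q is perpendicular to itself. *)
Lemma col_perp p q : col p q -> perp p q.
Proof.
move=> c; have := col_coplanar HP c (col_third HP c).
by rewrite (perpD HP) perpxx // (perp_sym HP) eqb_id.
Qed.

Lemma near2_perp p q r : near p q -> near q r -> perp p r.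
Proof.
case/orP=> [/eqP->|cpq] /orP[/eqP<-|cqr].
- exact: perpxx.
- exact: col_perp.
- exact: col_perp.
- by rewrite (col_sym HP) in cpq; apply: col_coplanar cqr.
Qed.

(** The incidence graph is bipartite: a walk between two points alternates lines
and points, and is coded by the pairs formed by a line and the next point. *)
Lemma walk_pairs n p q c : (size c <= n)%N ->
  path e (inl p) c -> last (inl p) c = inl q ->
  exists s : seq ({set T} * T), c = flatten [seq [:: inr x.1; inl x.2] | x <- s].
Proof.
elim: n p c => [|n IHn] p [|[?|l] [|[r|?] c]] //=; try by exists [::].
- rewrite ltnS => /ltnW szc /and3P[_ _ rc] lc.
  by have [s ->] := IHn r c szc rc lc; exists ((l, r) :: s).
- by rewrite !andbF.
Qed.

(** Walks of length 0, 2 and 4 only join perpendicular points, so two points that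
are not perpendicular are at distance 6. *)
Lemma inc_diameter : diameter (inc_vertex P L) e 6.
Proof.
split=> [u v uD vD|]; first by apply/within_distance/inc_within.
have [x [z [x0 z0 npxz]]] := non_perp HP.
have vx : inl x \in inc_vertex P L by rewrite -topredE /= inE.
have vz : inl z \in inc_vertex P L by rewrite -topredE /= inE.
have [k lek6 [wk mink]] := within_distance (inc_within vx vz).
exists (inl x), (inl z); split=> //.
suff <- : k = 6%N by split.
case: wk => c [ec lc sc]; have [s cE] := walk_pairs (leqnn _) ec lc.
move: ec lc; rewrite {}cE {c mink} in sc *; rewrite -{k}sc in lek6 *.
case: s lek6 => [|[l1 p1] [|[l2 p2] [|[l3 p3] [|]]]] //.
- by move=> _ _ [xz]; rewrite xz perpxx in npxz.
- move=> _ /and3P[e1 e2 _] [p1z]; rewrite p1z in e2.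
  by rewrite (near2_perp (edge_near e1 e2)) ?/near ?eqxx in npxz.
- move=> _ /and5P[e1 e2 e3 e4 _] [p2z]; rewrite p2z in e4.
  by rewrite (near2_perp (edge_near e1 e2) (edge_near e3 e4)) in npxz.
Qed.

Lemma edge_col p l q : e (inl p) (inr l) -> e (inr l) (inl q) -> p != q ->
  col p q /\ l = line p q.
Proof.
rewrite (inc_edge_sym (inr l)) => /edgeP[_ lL pl] /edgeP[_ _ ql].
exact: line_through.
Qed.

Lemma line_turn p q r : col p q -> col q r -> line p q != line q r ->
  r \notin line p q.
Proof.
move=> cpq cqr; apply: contra => rpq.
have /and3P[_ _ nqr] := col_neq HP cqr.
by have [|_ ->] := line_through (col_line cpq) _ rpq nqr; rewrite // in_line eqxx orbT.
Qed.

(** This excludes quadrangles and pentagons alike: for consecutive vertices p0,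
p1, p2 and the other neighbour q of p0, the vertex p2 is perpendicular to p0, p1
and q, which span the plane of the pencil on p0.  So p2 lies in that plane,
and p0, p1, p2 would be a triangle. *)
Lemma no_shortcut p0 p1 p2 q : col p0 p1 -> col p1 p2 -> col p0 q ->
  q \notin line p0 p1 -> p2 \notin line p0 p1 -> perp p2 q -> False.
Proof.
move=> c01 c12 c0q q01 p2_01 p2q.
have c21 : col p2 p1 by rewrite (col_sym HP).
have c10 : col p1 p0 by rewrite (col_sym HP).
have /and3P[_ p2_0 _] := col_neq HP c12.
have := pencil_maximal HP c01 c0q q01 p2_0 (col_coplanar HP c12 c10) (col_perp c21) p2q.
case/orP=> [/eqP p20|c02]; first by rewrite p20 in_line eqxx in p2_01.
by rewrite (no_triangle HP c01 c12 c02) in p2_01.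
Qed.

Lemma uniq_pairs (s : seq ({set T} * T)) :
  uniq (flatten [seq [:: inr x.1; inl x.2] | x <- s] : seq (T + {set T}))
  = uniq (map fst s) && uniq (map snd s).
Proof.
pose c (r : seq ({set T} * T)) : seq (T + {set T}) :=
  flatten [seq [:: inr x.1; inl x.2] | x <- r].
have memE r : ((forall l, (inr l \in c r) = (l \in map fst r))
             * (forall p, (inl p \in c r) = (p \in map snd r)))%type.
  by elim: r => //= x r [IHl IHp]; split=> y; rewrite !inE ?IHl ?IHp.
rewrite -/(c s).
by elim: s => //= x s IHs; rewrite inE !memE IHs /= !andbA (andbAC (_ \notin _)).
Qed.

#[local] Arguments inc_edge : simpl never.

(** A cycle of length 2k in the incidence graph is a k-gon of points; the four
cases are k = 2, 3, 4 and 5. *)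
Lemma no_short_closed_walk p c : path e (inl p) c -> last (inl p) c = inl p ->
  uniq c -> (2 < size c < 12)%N -> False.
Proof.
move=> ec lc uc szc; have [s cE] := walk_pairs (leqnn _) ec lc.
move: uc; rewrite cE uniq_pairs; move: ec lc szc; rewrite {}cE {c}.
case: s => [|[l0 p1] [|[l1 p2] [|[l2 p3] [|[l3 p4] [|[l4 p5] [|??]]]]]] //=.
- case/and5P=> e1 e2 e3 e4 _ [E]; rewrite {p2}E in e4 *.
  rewrite !inE ?negb_or ?andbT => _ /andP[n01 n10].
  have [_ l0E] := edge_col e1 e2 ltac:(by rewrite eq_sym).
  by have [_ l1E] := edge_col e3 e4 n10; rewrite l0E l1E line_sym eqxx in n01.
- case/and5P=> e1 e2 e3 e4 /and3P[e5 e6 _] [E]; rewrite {p3}E in e6 *.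
  rewrite !inE ?negb_or ?andbT -!andbA => _.
  case/and5P=> n01 n02 n12 m12 /andP[m10 m20].
  have [c01 l0E] := edge_col e1 e2 ltac:(by rewrite eq_sym).
  have [c12 l1E] := edge_col e3 e4 m12; have [c20 l2E] := edge_col e5 e6 m20.
  rewrite l0E l1E in n01; rewrite (col_sym HP) in c20.
  by have := line_turn c01 c12 n01; rewrite (no_triangle HP c01 c12 c20).
- case/and5P=> e1 e2 e3 e4 /and5P[e5 e6 e7 e8 _] [E]; rewrite {p4}E in e8 *.
  rewrite !inE ?negb_or ?andbT -!andbA => _.
  case/and5P=> n01 _ n03 _ /and5P[_ _ m12 _ /and4P[m10 m23 _ m30]].
  have [c01 l0E] := edge_col e1 e2 ltac:(by rewrite eq_sym).
  have [c12 l1E] := edge_col e3 e4 m12; have [c23 l2E] := edge_col e5 e6 m23.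
  have [c30 l3E] := edge_col e7 e8 m30.
  have c03 : col p p3 by rewrite (col_sym HP).
  have c10 : col p1 p by rewrite (col_sym HP).
  apply: (no_shortcut c01 c12 c03 _ _ (col_perp c23)).
    rewrite line_sym; apply: line_turn => //.
    by rewrite (line_sym p1 p) (line_sym p p3) -l0E -l3E.
  by apply: line_turn; rewrite // -l0E -l1E.
- case/and5P=> e1 e2 e3 e4 /and5P[e5 e6 e7 e8 /and3P[e9 e10 _]] [E].
  rewrite {p5}E in e10 *; rewrite !inE ?negb_or ?andbT -!andbA => _.
  case/and5P=> n01 _ _ n04 /and5P[_ _ _ _].
  case/and5P=> _ _ m12 _ /and5P[_ m10 m23 _ /and4P[_ m34 _ m40]].
  have [c01 l0E] := edge_col e1 e2 ltac:(by rewrite eq_sym).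
  have [c12 l1E] := edge_col e3 e4 m12; have [c23 l2E] := edge_col e5 e6 m23.
  have [c34 l3E] := edge_col e7 e8 m34; have [c40 l4E] := edge_col e9 e10 m40.
  have c04 : col p p4 by rewrite (col_sym HP).
  have c10 : col p1 p by rewrite (col_sym HP).
  have c32 : col p3 p2 by rewrite (col_sym HP).
  apply: (no_shortcut c01 c12 c04 _ _ (col_coplanar HP c32 c34)).
    rewrite line_sym; apply: line_turn => //.
    by rewrite (line_sym p1 p) (line_sym p p4) -l0E -l4E.
  by apply: line_turn; rewrite // -l0E -l1E.
Qed.

(** A line has only one point besides p and q. *)
Lemma hexagon_lines_neq p q r s : uniq [:: p; q; r; s] ->
  line p q != line r s.
Proof.
rewrite /= !inE !negb_or -!andbA.
case/and5P=> _ npr nps nqr /and3P[nqs nrs _]; apply/eqP=> E.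
have : r \in line p q by rewrite E in_line eqxx.
have : s \in line p q by rewrite E in_line eqxx orbT.
rewrite !in_line ![r == _]eq_sym ![s == _]eq_sym (negPf npr) (negPf nps).
by rewrite (negPf nqr) (negPf nqs) /= => /eqP sE /eqP rE; rewrite -sE -rE eqxx in nrs.
Qed.

Lemma inc_girth : girth (inc_vertex P L) e 12.
Proof.
split; last first.
  move=> c [cD /andP[ec uc] szc]; rewrite leqNgt; apply/negP=> ltc.
  wlog [p [c' cE]] : c cD ec uc szc ltc / exists p c', c = inl p :: c'.
    move=> IH; case: c => [|[p|l] c] in cD ec uc szc ltc *; first by [].
      by apply: (IH (inl p :: c)) => //; exists p, c.
    (* A cycle that starts at a line starts at a point after one rotation. *)
    apply: (IH (rot 1 (inr l :: c))).
    - by rewrite (eq_all_r (mem_rot _ _)).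
    - by rewrite rot_cycle.
    - by rewrite rot_uniq.
    - by rewrite size_rot.
    - by rewrite size_rot.
    case: c cD ec {uc szc ltc} => [//|[q|m] c] _ //.
    by rewrite rot1_cons; exists q, (rcons c (inr l)).
  subst c; apply: (@no_short_closed_walk p (rcons c' (inl p))) => //.
  - by rewrite last_rcons.
  - by rewrite rcons_uniq.
  - by rewrite size_rcons; apply/andP.
have [p0 [p1 [p2 [p3 [p4 [p5 [up cp turn]]]]]]] := ordinary_hexagon HP.
move: cp => /= /and5P[c01 c12 c23 c34 /and3P[c45 c50 _]].
pose s := [:: (line p0 p1, p1); (line p1 p2, p2); (line p2 p3, p3);
              (line p3 p4, p4); (line p4 p5, p5); (line p5 p0, p0)].
exists (flatten [seq [:: inr x.1; inl x.2] | x <- s]) => //.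
have vp p q : col p q -> (inl q \in inc_vertex P L) && (inr (line p q) \in inc_vertex P L).
  move=> cpq; have /and3P[_ q0 _] := col_neq HP cpq.
  by rewrite -!topredE /= inE q0 col_line.
have ee p q : col p q -> e (inl p) (inr (line p q)) && e (inr (line p q)) (inl q).
  move=> cpq; rewrite (inc_edge_sym (inr _)) !edge_mem ?col_line //.
    by rewrite in_line eqxx orbT.
  by rewrite in_line eqxx.
split=> //; last apply/andP; last split.
- have [/andP[v1 w1] /andP[v2 w2]] := (vp _ _ c01, vp _ _ c12).
  have [/andP[v3 w3] /andP[v4 w4]] := (vp _ _ c23, vp _ _ c34).
  have [/andP[v5 w5] /andP[v0 w0]] := (vp _ _ c45, vp _ _ c50).
  by rewrite /= v0 v1 v2 v3 v4 v5 w0 w1 w2 w3 w4 w5.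
- have [/andP[v1 w1] /andP[v2 w2]] := (ee _ _ c01, ee _ _ c12).
  have [/andP[v3 w3] /andP[v4 w4]] := (ee _ _ c23, ee _ _ c34).
  have [/andP[v5 w5] /andP[v0 w0]] := (ee _ _ c45, ee _ _ c50).
  by rewrite /= v0 v1 v2 v3 v4 v5 w0 w1 w2 w3 w4 w5.
rewrite uniq_pairs /=.
have adj p q r : r \notin line p q -> line p q != line q r.
  by apply: contra => /eqP->; rewrite in_line eqxx orbT.
case/and5P: turn => /adj t0 /adj t1 /adj t2 /adj t3 /andP[/adj t4 /adj t5].
have ne (x y : T) : x != y -> (x != y) * (y != x) by rewrite (eq_sym y).
move: up; rewrite /= !inE !negb_or -!andbA.
case/and5P=> /ne a01 /ne a02 /ne a03 /ne a04.
case/and5P=> /ne a05 /ne a12 /ne a13 /ne a14.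
case/and5P=> /ne a15 /ne a23 /ne a24 /ne a25 /and4P[/ne a34 /ne a35 /ne a45 _].
have n := (a01, a02, a03, a04, a05, (a12, a13, a14, a15, (a23, a24, a25, a34, a35, a45))).
rewrite t0 t1 t2 t3 t4 (eq_sym (line p0 p1) (line p5 p0)) t5.
by rewrite !hexagon_lines_neq //= ?inE ?negb_or ?n.
Qed.

Lemma inc_partial_linear_space : partial_linear_space P L 2 2.
Proof.
split.
- move=> l lL; split.
    by apply/subsetP=> p pl; rewrite inE (mem_lines_neq0 lL pl).
  case/linesP: lL => x [y [cxy ->]]; have /and3P[x0 y0 nxy] := col_neq HP cxy.
  have /and3P[_ xy0 nxxy] := col_neq HP (col_third HP cxy).
  rewrite /line setUC cardsU1 !inE cards2 nxy eq_sym (negPf nxxy) /=.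
  by rewrite -subr_eq0 addrK x0.
- move=> p; rewrite inE => p0.
  have [x [y [z [/and3P[cx cy cz] /and3P[nyx nzx nzy] cov]]]] := pencil HP p0.
  have dist u v : v \notin line p u -> line p u != line p v.
    by apply: contra => /eqP->; rewrite in_line eqxx orbT.
  suff -> : [set l in L | p \in l] = line p x |: [set line p y; line p z].
    by rewrite cardsU1 cards2 !inE negb_or !dist.
  apply/setP=> l; rewrite [LHS]inE in_setU1 in_set2.
  apply/andP/or3P => [[lL pl]|]; last first.
    by case=> /eqP->; rewrite col_line // in_line eqxx.
  have [q ql npq] : exists2 q, q \in l & p != q.
    case/linesP: lL => a [b [cab lE]]; have /and3P[_ _ nab] := col_neq HP cab.
    case: (eqVneq p a) => [pa|npa].
      by exists b; rewrite ?pa // lE in_line eqxx orbT.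
    by exists a; rewrite // lE in_line eqxx.
  have [cpq lE] := line_through lL pl ql npq.
  have thr u : q \in line p u -> col p u -> l == line p u.
    move=> qu cu; apply/eqP; rewrite lE; symmetry.
    by apply: (line_through (col_line cu) _ qu npq).2; rewrite in_line eqxx.
  by have /or3P[] := cov q cpq => /thr E;
    [constructor 1|constructor 2|constructor 3]; apply: E.
- move=> p q _ _ npq; rewrite -(cards1 (line p q)); apply/subset_leq_card.
  apply/subsetP=> l; rewrite inE => /and3P[lL pl ql]; rewrite inE.
  by have [_ ->] := line_through lL pl ql npq.
Qed.

Theorem pencils_generalized_hexagon : generalized_hexagon P L 2 2.
Proof.
split; [exact: inc_partial_linear_space | exact: inc_diameter | exact: inc_girth].
Qed.

End FlatPencils.

(** * The explicit geometry on F_4^3 *)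
Lemma natr_addb (R : nzRingType) (b c : bool) :
  2%N \in [pchar R] -> (b (+) c)%:R = b%:R + c%:R :> R.
Proof.
move=> R2; move: b c => [] []; rewrite /= ?mulr0n ?mulr1n ?addr0 ?add0r //.
by rewrite addrr_pchar2.
Qed.

Lemma natr_andb (R : nzRingType) (b c : bool) : (b && c)%:R = b%:R * c%:R :> R.
Proof. by move: b c => [] []; rewrite /= ?mulr0n ?mulr1n ?mulr1 ?mulr0. Qed.

(** The pair (b, c) stands for b + c w, so that addition is bitwise. *)
Definition GF4 : Type := (bool * bool)%type.
Definition GF4_3 : Type := (GF4 * GF4 * GF4)%type.

HB.instance Definition _ := GRing.Zmodule.on GF4.
HB.instance Definition _ := Finite.on GF4.
HB.instance Definition _ := GRing.Zmodule.on GF4_3.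
HB.instance Definition _ := Finite.on GF4_3.

Definition mul4 (a b : GF4) : GF4 :=
  ((a.1 && b.1) (+) (a.2 && b.2), (a.1 && b.2) (+) (a.2 && b.1) (+) (a.2 && b.2)).
Definition conj4 (a : GF4) : GF4 := (a.1 (+) a.2, a.2).
Definition w4 : GF4 := (false, true).

Definition scale4 (s : GF4) (m : GF4_3) : GF4_3 :=
  (mul4 s m.1.1, mul4 s m.1.2, mul4 s m.2).
Definition herm4 (m n : GF4_3) : GF4 :=
  mul4 m.1.1 (conj4 n.1.1) + mul4 m.1.2 (conj4 n.1.2) + mul4 m.2 (conj4 n.2).
(** The cube of a nonzero scalar is 1, so that the product of the coordinates of
a vector only depends on the point that it spans.  For unit vectors, its value
tells the four orthogonal triangles apart. *)
Definition prod4 (m : GF4_3) : GF4 := mul4 (mul4 m.1.1 m.1.2) m.2.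

Definition iso4 (m : GF4_3) := (m != 0) && (herm4 m m == 0).
Definition unit4 (m : GF4_3) := herm4 m m == (true, false).
(** The second bit of the product vanishes when the product is 0 or 1: these are
the unit vectors over the hyperoval, those of [coval4] lie over the six other
non-isotropic points. *)
Definition oval4 (m : GF4_3) := unit4 m && ~~ (prod4 m).2.
Definition coval4 (m : GF4_3) := unit4 m && (prod4 m).2.

(** The vector m belongs to the line L(a) defined by the set W. *)
Definition tangent4 (W : pred GF4_3) (a m : GF4_3) :=
  [&& iso4 a, W m, herm4 a m == 0 & W (a + m)].
(** In a line L(a) = {a, x, a + x} the isotropic vector a may be any one of m, n
and m + n. *)
Definition tangent_col4 (W : pred GF4_3) (m n : GF4_3) :=
  [|| tangent4 W m n, tangent4 W n m | tangent4 W (m + n) m].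
Definition spread_col4 (m n : GF4_3) :=
  iso4 m && (n == scale4 w4 m) || iso4 n && (m == scale4 w4 n).
Definition col4 (m n : GF4_3) :=
  [|| spread_col4 m n, tangent_col4 oval4 m n | tangent_col4 coval4 m n].
(** The trace of b + c w is c. *)
Definition perp4 (m n : GF4_3) := ~~ (herm4 m n).2.

Definition GF4s : seq GF4 := [seq (b, c) | b <- [:: false; true], c <- [:: false; true]].
Definition GF4_3s : seq GF4_3 :=
  [seq (p, c) | p <- [seq (a, b) | a <- GF4s, b <- GF4s], c <- GF4s].

Lemma mem_GF4_3s m : m \in GF4_3s.
Proof. by case: m => [[[[] []] [[] []]] [[] []]]; vm_compute. Qed.

(** The statements about F_4^3 are decided by running through its vectors.  In
the predicates below a conditional often takes the place of an implication, to
the effect that its conclusion is evaluated only where the premise holds. *)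
Lemma GF4_3_forall (P : pred GF4_3) : all P GF4_3s -> forall m, P m.
Proof. by move=> /allP PM m; apply/PM/mem_GF4_3s. Qed.

Lemma GF4_3_forall2 (P : rel GF4_3) :
  all (fun m => all (P m) GF4_3s) GF4_3s -> forall m n, P m n.
Proof.
move=> PM m; apply: GF4_3_forall.
exact: (GF4_3_forall (P := fun m => all (P m) GF4_3s)).
Qed.

Definition nbrs4 m := [seq n <- GF4_3s | col4 m n].
Definition line4 (m n : GF4_3) := [:: m; n; m + n].
Arguments line4 : simpl never.

Lemma mem_nbrs4 m n : (n \in nbrs4 m) = col4 m n.
Proof. by rewrite mem_filter mem_GF4_3s andbT. Qed.

Lemma GF4_3_addxx (m : GF4_3) : m + m = 0.
Proof. by apply/eqP; move: m; apply: GF4_3_forall; vm_compute. Qed.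

Lemma mul4Dr a b c : mul4 a (b + c) = mul4 a b + mul4 a c.
Proof. by move: a b c => [[] []] [[] []] [[] []]; vm_compute. Qed.

Lemma conj4D a b : conj4 (a + b) = conj4 a + conj4 b.
Proof. by move: a b => [[] []] [[] []]; vm_compute. Qed.

Lemma herm4Dr m n n' : herm4 m (n + n') = herm4 m n + herm4 m n'.
Proof.
rewrite /herm4 !conj4D !mul4Dr [in RHS]addrACA; congr (_ + _).
by rewrite addrACA.
Qed.

Lemma perp4D m n n' : perp4 m (n + n') = (perp4 m n == perp4 m n').
Proof. by rewrite /perp4 herm4Dr; case: (herm4 m n) (herm4 m n') => [a []] [b []]. Qed.

Lemma perp4_sym : symmetric perp4.
Proof. by move=> m n; apply/eqP; move: m n; apply: GF4_3_forall2; vm_compute. Qed.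

Lemma perp4xx : reflexive perp4.
Proof. by apply: GF4_3_forall; vm_compute. Qed.

Lemma col4_sym : symmetric col4.
Proof. by move=> m n; apply/eqP; move: m n; apply: GF4_3_forall2; vm_compute. Qed.

(** A vector is collinear with at most 6 others, which keeps statements about two
collinear pairs small. *)
Lemma all_nbrs4P (P : GF4_3 -> GF4_3 -> bool) :
  all (fun m => all (P m) (nbrs4 m)) GF4_3s -> forall m n, col4 m n -> P m n.
Proof.
move=> PM m n cmn; have := GF4_3_forall (P := fun m => all (P m) (nbrs4 m)) PM m.
by move=> /allP; apply; rewrite mem_nbrs4.
Qed.

Lemma all_nbrs4_pairP (P : GF4_3 -> GF4_3 -> GF4_3 -> bool) :
  all (fun m => let N := nbrs4 m in all (fun n => all (P m n) N) N) GF4_3s ->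
  forall m n n', col4 m n -> col4 m n' -> P m n n'.
Proof.
move=> PM m n n' cn cn'; have := GF4_3_forall (P := fun m => _) PM m.
by move=> /allP/(_ n) /[!mem_nbrs4]/(_ cn)/allP/(_ n') /[!mem_nbrs4]; apply.
Qed.

Lemma col4_neq m n : col4 m n -> [&& m != 0, n != 0 & m != n].
Proof. by move: m n; apply: all_nbrs4P; vm_compute. Qed.

Lemma col4_third m n : col4 m n -> col4 m (m + n).
Proof. by move: m n; apply: all_nbrs4P; vm_compute. Qed.

Lemma col4_coplanar p m n : col4 p m -> col4 p n -> perp4 m n.
Proof. by move: p m n; apply: all_nbrs4_pairP; vm_compute. Qed.

Lemma col4_pencil p : p != 0 -> exists x y z,
    [/\ [&& col4 p x, col4 p y & col4 p z],
        [&& y \notin line4 p x, z \notin line4 p x & z \notin line4 p y]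
      & forall q, col4 p q -> [|| q \in line4 p x, q \in line4 p y | q \in line4 p z]].
Proof.
(* Each pencil line is spanned by the first neighbour off the previous ones. *)
have /implyP H := GF4_3_forall (P := fun p => (p != 0) ==>
    let N := nbrs4 p in let x := head 0 N in
    let N1 := [seq q <- N | q \notin line4 p x] in let y := head 0 N1 in
    let N2 := [seq q <- N1 | q \notin line4 p y] in let z := head 0 N2 in
    [&& x \in N, y \in N1, z \in N2 & all (mem (line4 p z)) N2])
  ltac:(by vm_compute) p.
move=> /H /=; set x := head 0 _; set y := head 0 _; set z := head 0 _.
rewrite !mem_filter !mem_GF4_3s !andbT.
case/and4P=> cx /andP[nyx cy] /and3P[nzy nzx cz] /allP cov.
exists x, y, z; split; [by rewrite cx cy cz | by rewrite nyx nzx nzy |].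
move=> q cq.
case qx: (q \in line4 p x) => //=; case qy: (q \in line4 p y) => //=.
by apply: cov; rewrite !mem_filter qy qx cq mem_GF4_3s.
Qed.

Lemma col4_pencil_maximal p m n q : col4 p m -> col4 p n -> n \notin line4 p m ->
  q != 0 -> perp4 q p -> perp4 q m -> perp4 q n -> (q == p) || col4 p q.
Proof.
move=> cm cn /negPf nl q0 qp qm qn.
have := all_nbrs4_pairP (P := fun p m n => if n \in line4 p m then true else
  all (fun q => if perp4 q p then if perp4 q m then if perp4 q n then
                  [|| q == 0, q == p | col4 p q] else true else true else true) GF4_3s)
  ltac:(by vm_compute) cm cn.
by rewrite nl => /allP/(_ q (mem_GF4_3s q)); rewrite qp qm qn (negPf q0).
Qed.

Lemma col4_no_triangle m n q : col4 m n -> col4 n q -> col4 m q -> q \in line4 m n.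
Proof.
move=> cmn cnq cmq; apply/implyP: cnq.
exact: (all_nbrs4_pairP (P := fun m n q => col4 n q ==> (q \in line4 m n))
  ltac:(by vm_compute) cmn cmq).
Qed.

Lemma perp4_connected m q : m != 0 -> q != 0 -> perp4 m q ->
  exists2 n, (m == n) || col4 m n & (n == q) || col4 n q.
Proof.
move=> m0 q0 pmq.
have := GF4_3_forall (P := fun m => if m == 0 then true else let N := m :: nbrs4 m in
  all (fun q => if (q == 0) || ~~ perp4 m q then true else
                has (fun n => (n == q) || col4 n q) N) GF4_3s)
  ltac:(by vm_compute) m.
rewrite (negPf m0) => /allP/(_ q (mem_GF4_3s q)); rewrite (negPf q0) pmq => /hasP[n nN nq].
by exists n => //; move: nN; rewrite in_cons mem_nbrs4 eq_sym.
Qed.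

Lemma ordinary_hexagon4 : exists p0 p1 p2 p3 p4 p5 : GF4_3,
  [/\ uniq [:: p0; p1; p2; p3; p4; p5],
      cycle col4 [:: p0; p1; p2; p3; p4; p5]
    & [&& p2 \notin line4 p0 p1, p3 \notin line4 p1 p2, p4 \notin line4 p2 p3,
          p5 \notin line4 p3 p4, p0 \notin line4 p4 p5 & p1 \notin line4 p5 p0]].
Proof.
exists (false, false, (false, false), (true, false)).
exists (true, false, (true, false), (false, false)).
exists (true, true, (true, true), (false, false)).
exists (false, false, (false, false), (true, true)).
exists (false, true, (true, false), (false, false)).
exists (true, true, (false, true), (false, false)).
by split; vm_compute.
Qed.

(** The axioms only involve addition, so they hold in any additive copy of F_4^3. *)
Section Transport.
Variables (T : finZmodType) (f : GF4_3 -> T) (g : T -> GF4_3).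
Hypotheses (fK : cancel f g) (gK : cancel g f).
Hypothesis fD : {morph f : m n / m + n >-> m + n}.
Let col x y := col4 (g x) (g y).
Let perp x y := perp4 (g x) (g y).

Lemma transport_add x y : g (x + y) = g x + g y.
Proof. by rewrite -{1}(gK x) -{1}(gK y) -fD fK. Qed.

Lemma transport0 : f 0 = 0.
Proof. by apply: (addrI (f 0)); rewrite -fD !addr0. Qed.

Lemma transport_neq0 x : (g x != 0) = (x != 0).
Proof. by rewrite -(can_eq fK) gK transport0. Qed.

Lemma transport_line m n p : (f p \in line (f m) (f n)) = (p \in line4 m n).
Proof. by rewrite in_line -fD !(can_eq fK) !inE. Qed.

Lemma transport_mem_line x y z : (z \in line x y) = (g z \in line4 (g x) (g y)).
Proof. by rewrite -transport_line !gK. Qed.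

Lemma model_hexagonal_pencils : hexagonal_pencils perp col.
Proof.
have gI : injective g := can_inj gK.
split.
- by move=> x; apply: gI; rewrite transport_add GF4_3_addxx -transport0 fK.
- by move=> x y; apply: perp4_sym.
- by move=> x; apply: perp4xx.
- by move=> x y z; rewrite /perp transport_add perp4D.
- by move=> x y; apply: col4_sym.
- by move=> x y /col4_neq; rewrite !transport_neq0 (can_eq gK).
- by move=> x y /col4_third; rewrite /col transport_add.
- by move=> p x y; apply: col4_coplanar.
- move=> p; rewrite -transport_neq0 => /col4_pencil[x [y [z [c n cov]]]].
  exists (f x), (f y), (f z); rewrite /col !fK !transport_mem_line !fK; split=> //.
  by move=> q; rewrite !transport_mem_line !fK; apply: cov.
- move=> p x y z; rewrite transport_mem_line -(transport_neq0 z) -(can_eq gK z).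
  exact: col4_pencil_maximal.
- by move=> x y z; rewrite transport_mem_line; apply: col4_no_triangle.
- move=> x z; rewrite -2!transport_neq0 => x0 z0 pxz.
  have [n xn nz] := perp4_connected x0 z0 pxz.
  by exists (f n); rewrite /col -(can_eq gK) !fK.
- have [p0 [p1 [p2 [p3 [p4 [p5 [up cp turn]]]]]]] := ordinary_hexagon4.
  exists (f p0), (f p1), (f p2), (f p3), (f p4), (f p5); split.
  + by have := map_inj_uniq (can_inj fK) [:: p0; p1; p2; p3; p4; p5] => /= ->.
  + by move: cp; rewrite /= /col !fK.
  + by rewrite !transport_line.
(* For a unit vector x, h (w x, x) = w has trace 1. *)
pose e1 : GF4_3 := (true, false, (false, false), (false, false)).
exists (f e1), (f (scale4 w4 e1)).
by rewrite -2!transport_neq0 /perp !fK; split; vm_compute.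
Qed.

End Transport.

(** The vectors of W orthogonal to a span two projective points, one for each of
the two triangles of unit vectors in W.  If [x] is one of them, the other one is
[x + l a] for a single nonzero scalar l, and a + k x is in W exactly when k l is
1.  This leaves the two vectors k x and a + k x. *)
Lemma tangent4_unique (W : pred GF4_3) : (W =1 oval4) \/ (W =1 coval4) ->
  forall a, iso4 a -> exists2 m, tangent4 W a m &
    forall n, tangent4 W a n = (n \in [:: m; a + m]).
Proof.
have key (X : pred GF4_3) : all (fun a => if iso4 a then
    let S := [seq m <- GF4_3s | tangent4 X a m] in let m := head 0 S in
    all (fun n => tangent4 X a n == (n \in [:: m; a + m])) GF4_3s else true) GF4_3s ->
  forall W, W =1 X -> forall a, iso4 a -> exists2 m, tangent4 W a m &
    forall n, tangent4 W a n = (n \in [:: m; a + m]).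
  move=> chk V eVX a isoa; have := GF4_3_forall chk a; cbv beta zeta; rewrite isoa.
  set m := head 0 _ => /allP H.
  have {}H n : tangent4 V a n = (n \in [:: m; a + m]).
    by rewrite -(eqP (H n (mem_GF4_3s n))) /tangent4 !eVX.
  by exists m => //; rewrite H inE eqxx.
by case; apply: key; vm_compute.
Qed.

(** * The field of order four and orthonormal frames *)
Section FieldOfOrderFour.
Variables (F : finFieldType) (w : F).
Hypotheses (cardF : #|F| = 4%N) (hw : w ^+ 2 + w + 1 = 0).

Definition val4 (a : GF4) : F := a.1%:R + a.2%:R * w.

Lemma pchar2 : 2%N \in [pchar F].
Proof. exact: (@card_finPcharP F 2 2). Qed.

Lemma add_self4 (x : F) : x + x = 0.
Proof. exact: addrr_pchar2 pchar2 x. Qed.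

Lemma w_sqr : w ^+ 2 = 1 + w.
Proof.
apply/eqP; rewrite -subr_eq0 (oppr_pchar2 pchar2) (addrC 1) addrA; exact/eqP.
Qed.

Lemma val4D a b : val4 (a + b) = val4 a + val4 b.
Proof.
move: a b => [a1 a2] [b1 b2]; rewrite /val4 /= !(natr_addb _ _ pchar2) mulrDl.
by rewrite addrACA.
Qed.

Lemma val4M a b : val4 (mul4 a b) = val4 a * val4 b.
Proof.
case: a b => [a1 a2] [b1 b2]; rewrite /val4 /mul4 /= !(natr_addb _ _ pchar2) !natr_andb.
transitivity (a1%:R * b1%:R + (a1%:R * b2%:R + a2%:R * b1%:R) * w
              + a2%:R * b2%:R * w ^+ 2 : F); last by ring.
by rewrite w_sqr; ring.
Qed.

Lemma val4_conj a : val4 (conj4 a) = val4 a ^+ 2.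
Proof.
rewrite expr2 -val4M; congr val4; by case: a => [[] []].
Qed.

Lemma val4_eq0 a : (val4 a == 0) = (a == 0).
Proof.
apply/eqP/eqP => [|->]; last by rewrite /val4 mul0r addr0.
case: a => [[] []] //; rewrite /val4 /= ?mul1r ?mul0r ?addr0 ?add0r.
- move=> E; have := hw; rewrite -addrA (addrC w) E addr0 => /eqP.
  rewrite sqrf_eq0 => /eqP w0; move: E; rewrite w0 addr0 => /eqP.
  by rewrite oner_eq0.
- by move/eqP; rewrite oner_eq0.
- by move=> w0; move/eqP: hw; rewrite w0 expr0n !add0r oner_eq0.
Qed.

Lemma val4_inj : injective val4.
Proof.
move=> a b /eqP; rewrite -subr_eq0 (oppr_pchar2 pchar2) -val4D val4_eq0.
by move: a b => [[] []] [[] []].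
Qed.

Lemma val4_onto x : exists a, x = val4 a.
Proof.
have [|g gK Kg] := @inj_card_bij GF4 F val4 val4_inj.
  by rewrite cardF card_prod card_bool.
by exists (g x); rewrite Kg.
Qed.

End FieldOfOrderFour.

Section UnitaryFrames.
Variables (F : finFieldType) (w : F).
Hypotheses (cardF : #|F| = 4%N) (hw : w ^+ 2 + w + 1 = 0).
Variables (conj : {rmorphism F -> F}) (conjE : forall a : F, conj a = a ^+ 2).
Variables (V : vectType F) (dimV : \dim {:V} = 3%N).
Variables (h : {hermitian_sym V for conj}) (hnd : nondegenerate h).
Local Notation val4 := (val4 w).

Lemma herm_swap (x y : V) : h x y = h y x ^+ 2.
Proof. by rewrite hermC expr0 mul1r conjE. Qed.

Lemma herm_swap0 (x y : V) : h x y = 0 -> h y x = 0.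
Proof. by rewrite (herm_swap y) => ->; rewrite expr0n. Qed.

Lemma herm_norm (x : V) : h x x != 0 -> h x x = 1.
Proof.
move=> nz; apply: (mulfI nz); rewrite mulr1 -expr2; symmetry; exact: herm_swap.
Qed.

Lemma norm_scale (a : F) (x : V) : a != 0 -> h (a *: x) (a *: x) = h x x.
Proof.
move=> a0; rewrite linearZl linearZr /= conjE mulrA -exprS.
suff -> : a ^+ 3 = 1 by rewrite mul1r.
by apply: (mulfI a0); rewrite -exprS -[in LHS]cardF expf_card mulr1.
Qed.

Definition frame (e1 e2 e3 : V) := [/\ h e1 e1 = 1, h e2 e2 = 1 & h e3 e3 = 1] /\
  [/\ h e1 e2 = 0, h e1 e3 = 0 & h e2 e3 = 0].

(** Otherwise U is totally isotropic.  Polarization then puts h x y, and also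
h (w x) y = w h x y, into the prime field, so h vanishes on U.  As every v acts
on U as some element of U does, U lies in the radical of h. *)
Lemma exists_unit (U : {vspace V}) : U != 0%VS ->
  (forall v, exists2 u, u \in U & forall x, x \in U -> h x v = h x u) ->
  exists2 x, x \in U & h x x = 1.
Proof.
move=> U0 proj.
case: (pickP (fun x : finvect_type V => ((x : V) \in U) && (h x x != 0)))
  => [x /andP[xU xx]|no].
  by exists x => //; apply: herm_norm.
have iso x : x \in U -> h x x = 0.
  by move=> xU; have := no x; rewrite /= xU => /negbT; rewrite negbK => /eqP.
have hsym x y : x \in U -> y \in U -> h x y ^+ 2 = h x y.
  move=> xU yU; have := iso _ (rpredD xU yU).
  rewrite linearDl !linearDr /= !iso // add0r addr0 (herm_swap y x) => /eqP.
  by rewrite addrC addr_eq0 (oppr_pchar2 (pchar2 cardF)) => /eqP.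
have h0 x y : x \in U -> y \in U -> h x y = 0.
  move=> xU yU; apply/eqP; case: eqP => // /eqP nz.
  have h1 : h x y = 1 by apply: (mulfI nz); rewrite mulr1 -expr2 hsym.
  have := hsym (w *: x) y (rpredZ _ xU) yU.
  rewrite linearZl /= h1 mulr1 (w_sqr cardF hw) => /eqP.
  by rewrite -subr_eq0 addrK oner_eq0.
have : vpick U \in orthov h fullv.
  apply/mem_orthovP => v _; have [u uU ->] := proj v; last exact: memv_pick.
  by apply: h0; rewrite // memv_pick.
by rewrite (eqP hnd) memv0 vpick0 (negPf U0).
Qed.

Lemma exists_frame e1 : h e1 e1 = 1 -> exists e2 e3, frame e1 e2 e3.
Proof.
move=> h11; pose U := orthov h <[e1]>%VS.
have dU : (1 < \dim U)%N.
  by have := leq_dim_orthov1 h e1 fullv; rewrite dimV capfv.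
have inU x : (x \in U) = (h x e1 == 0) by rewrite mem_orthov1.
have [||e2 e2U h22] := @exists_unit U.
- by rewrite -dimv_eq0 -lt0n ltnW.
- move=> v; exists (v - h v e1 *: e1).
    by rewrite inU linearBl linearZl /= h11 mulr1 subrr.
  move=> x; rewrite inU => /eqP x1.
  by rewrite linearBr linearZr /= x1 mulr0 subr0.
have h21 : h e2 e1 = 0 by apply/eqP; rewrite -inU.
have h12 := herm_swap0 h21.
pose U2 := (U :&: orthov h <[e2]>)%VS.
have inU2 x : (x \in U2) = (h x e1 == 0) && (h x e2 == 0).
  by rewrite memv_cap inU mem_orthov1.
have [||e3 e3U h33] := @exists_unit U2.
- rewrite -dimv_eq0 -lt0n; apply: leq_trans (leq_dim_orthov1 h e2 U).
  by case: (\dim U) dU => [|[]].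
- move=> v; exists (v - h v e1 *: e1 - h v e2 *: e2).
    rewrite inU2 !linearBl !linearZl /= h11 h22 h21 h12.
    by rewrite !mulr0 !mulr1 !subr0 !subrr eqxx.
  move=> x; rewrite inU2 => /andP[/eqP x1 /eqP x2].
  by rewrite !linearBr !linearZr /= x1 x2 !mulr0 !subr0.
move: e3U; rewrite inU2 => /andP[/eqP h31 /eqP h32].
by exists e2, e3; split; split=> //; exact: herm_swap0.
Qed.

End UnitaryFrames.

Definition basis4_1 : GF4_3 := (true, false, (false, false), (false, false)).
Definition basis4_2 : GF4_3 := (false, false, (true, false), (false, false)).
Definition basis4_3 : GF4_3 := (false, false, (false, false), (true, false)).

Lemma herm4_coord m : m = (herm4 m basis4_1, herm4 m basis4_2, herm4 m basis4_3).
Proof. by apply/eqP; move: m; apply: GF4_3_forall; vm_compute. Qed.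

Section Coordinates.
Variables (F : finFieldType) (w : F).
Hypotheses (cardF : #|F| = 4%N) (hw : w ^+ 2 + w + 1 = 0).
Variables (conj : {rmorphism F -> F}) (conjE : forall a : F, conj a = a ^+ 2).
Variables (V : vectType F) (dimV : \dim {:V} = 3%N).
Variables (h : {hermitian_sym V for conj}).
Local Notation val4 := (val4 w).
Local Notation fV := (finvect_type V).
Variables (e1 e2 e3 : V).
Hypothesis eF : frame h e1 e2 e3.

Definition vec (m : GF4_3) : fV := val4 m.1.1 *: e1 + val4 m.1.2 *: e2 + val4 m.2 *: e3.

Lemma herm_vec m n : h (vec m) (vec n) = val4 (herm4 m n).
Proof.
have [[h11 h22 h33] [h12 h13 h23]] := eF.
have h21 := herm_swap0 conjE h12; have h31 := herm_swap0 conjE h13.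
have h32 := herm_swap0 conjE h23.
rewrite /vec !linearDl !linearDr !linearZl !linearZr /=.
rewrite h11 h22 h33 h12 h13 h23 h21 h31 h32 !conjE.
rewrite /herm4 !val4D // !val4M // !val4_conj //; ring.
Qed.

Lemma vecD : {morph vec : m n / m + n >-> m + n}.
Proof.
move=> m n; rewrite /vec !val4D // !scalerDl [RHS]addrACA; congr (_ + _).
by rewrite [RHS]addrACA.
Qed.

Lemma vec_scale a m : vec (scale4 a m) = val4 a *: vec m.
Proof. by rewrite /vec !val4M // !scalerDr !scalerA. Qed.

Lemma vec_inj : injective vec.
Proof.
move=> m n E; have H k : herm4 m k = herm4 n k.
  by apply: (val4_inj cardF hw); rewrite -!herm_vec E.
by rewrite (herm4_coord m) (herm4_coord n) !H.
Qed.

Lemma vec_bij : bijective vec.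
Proof.
apply: inj_card_bij vec_inj _.
have -> : #|{: fV}| = (#|F| ^ \dim {: V})%N.
  rewrite -[LHS](card_vspacef (T := fV) (Vector.class (fV : vectType F))).
  exact: (card_vspace (T := fV) (cvT := Vector.class (fV : vectType F))).
by rewrite cardF dimV !card_prod card_bool.
Qed.
End Coordinates.

(** * The hyperoval in an adapted frame *)
Section Hyperoval.
Variables (F : finFieldType) (w : F).
Hypotheses (cardF : #|F| = 4%N) (hw : w ^+ 2 + w + 1 = 0).
Variables (V : vectType F) (H0 : {set {set finvect_type V}}).
Local Notation fV := (finvect_type V).
Local Notation pt := (pg_point w).
Hypothesis H0_hyperoval : hyperoval w H0.

Lemma pg_point_refl (x : fV) : x \in pt x.
Proof. by rewrite !inE eqxx. Qed.

Lemma w_cube : w ^+ 3 = 1.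
Proof.
have E : w ^+ 3 - 1 = (w - 1) * (w ^+ 2 + w + 1) by ring.
by apply/eqP; rewrite -subr_eq0 E hw mulr0.
Qed.

Lemma val4_w : val4 w w4 = w.
Proof. by rewrite /val4 /= mul1r add0r. Qed.

Lemma val4_w2 : val4 w (true, true) = w ^+ 2.
Proof. by rewrite /val4 /= mul1r (w_sqr cardF hw). Qed.

Lemma pg_point_scale (a : F) (x : fV) : a != 0 -> pt (a *: x) = pt x.
Proof.
have w4E : w * w ^+ 2 = 1 by rewrite -exprS w_cube.
have [b ->] := val4_onto cardF hw a; rewrite val4_eq0 //.
case: b => [[] []] // _.
- rewrite val4_w2 /pg_point !scalerA w4E.
  have -> : w ^+ 2 * w ^+ 2 = w by rewrite -exprD exprS w_cube mulr1.
  by rewrite scale1r [RHS]setUC setUA.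
- by rewrite /val4 /= mul0r addr0 scale1r.
rewrite val4_w /pg_point !scalerA -expr2 -exprSr w_cube scale1r.
by rewrite setUC setUA.
Qed.

Lemma pg_point_sub (U : {vspace V}) (x : fV) :
  [forall z in pt x, (z : V) \in U] = ((x : V) \in U).
Proof.
apply/forall_inP/idP => [|xU z]; first by apply; rewrite pg_point_refl.
by rewrite !inE -orbA => /or3P[] /eqP->; rewrite ?rpredZ.
Qed.

Lemma pg_point_mem (x y : fV) : pt x = pt y -> exists2 a, a != 0 & x = a *: y.
Proof.
have w0 : w != 0.
  by apply: contraTneq (oner_neq0 F) => w0; rewrite -w_cube w0 expr0n eqxx.
move=> E; have : x \in pt y by rewrite -E pg_point_refl.
rewrite !inE -orbA => /or3P[] /eqP->; [exists 1|exists w|exists (w ^+ 2)] => //.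
- exact: oner_neq0.
- by rewrite scale1r.
- by rewrite expf_neq0.
Qed.

Lemma hyperoval_second (U : {vspace V}) (x : fV) : \dim U = 2%N ->
  pt x \in H0 -> (x : V) \in U ->
  exists y : fV, [/\ pt y \in H0, (y : V) \in U & pt y != pt x].
Proof.
have [H0pt _ H02] := H0_hyperoval; move=> dU xH xU.
set K := [set p in H0 | [forall z in p, (z : V) \in U]].
have xK : pt x \in K by rewrite inE xH pg_point_sub.
have cK : #|K| = 2%N.
  by case: (H02 U dU) => // K0; move: xK; rewrite /K (cards0_eq K0) inE.
have : (0 < #|K :\ pt x|)%N by move: cK; rewrite (cardsD1 (pt x)) xK add1n => -[->].
case/card_gt0P=> p; rewrite !inE => /and3P[npx pH pU].
have [y _ pE] := H0pt p pH; rewrite {}pE pg_point_sub in npx pH pU.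
by exists y.
Qed.

Lemma hyperoval_no_three (U : {vspace V}) (x y z : fV) : \dim U = 2%N ->
  (x : V) \in U -> (y : V) \in U -> (z : V) \in U ->
  pt x \in H0 -> pt y \in H0 -> pt z \in H0 ->
  pt x != pt y -> pt x != pt z -> pt y != pt z -> False.
Proof.
have [_ _ H02] := H0_hyperoval; move=> dU xU yU zU xH yH zH nxy nxz nyz.
have le3 : (3 <= #|[set p in H0 | [forall z in p, (z : V) \in U]]|)%N.
  have -> : 3%N = #|[set pt x; pt y; pt z]|.
    by rewrite setUC cardsU1 cards2 !inE nxy negb_or eq_sym nxz eq_sym nyz.
  apply/subset_leq_card/subsetP=> p; rewrite [p \in [set pt x; _; _]]inE !inE -orbA.
  by case/or3P=> /eqP->; rewrite pg_point_sub ?xH ?yH ?zH.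
by case: (H02 U dU) le3 => ->.
Qed.
End Hyperoval.

Definition pg4 (m : GF4_3) : seq GF4_3 := [:: m; scale4 w4 m; scale4 (true, true) m].
Definition ones4 : GF4_3 := (true, false, (true, false), (true, false)).

(** The norm of a vector is the parity of its number of nonzero coordinates. *)
Lemma unit4_prod0 m : unit4 m -> prod4 m = 0 ->
  [|| m \in pg4 basis4_1, m \in pg4 basis4_2 | m \in pg4 basis4_3].
Proof.
move=> um pm; suff : unit4 m && (prod4 m == 0) ==>
   [|| m \in pg4 basis4_1, m \in pg4 basis4_2 | m \in pg4 basis4_3].
  by rewrite um pm eqxx.
by move: m {um pm}; apply: GF4_3_forall; vm_compute.
Qed.

(** A vector over the frame's triangle is orthogonal to one of its vertices, and a
vector with product 1 is orthogonal or proportional to (1, 1, 1). *)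
Lemma oval4_cases m : oval4 m ->
  [|| herm4 basis4_1 m == 0, herm4 basis4_2 m == 0, herm4 basis4_3 m == 0,
      herm4 ones4 m == 0 | m \in pg4 ones4].
Proof. by move=> om; apply/implyP: om; move: m; apply: GF4_3_forall; vm_compute. Qed.

(** The tangent line through (1, 0, 0) and m carries one point of each of the four
triangles, in particular a point with product 1. *)
Lemma coval4_cases m : coval4 m -> exists a n,
  [/\ n = m + scale4 a basis4_1, oval4 n,
      m \notin pg4 basis4_1, n \notin pg4 basis4_1 & n \notin pg4 m].
Proof.
move=> cm; have : has (fun a => let n := m + scale4 a basis4_1 in
  [&& oval4 n, m \notin pg4 basis4_1, n \notin pg4 basis4_1 & n \notin pg4 m]) GF4s.
  by apply/implyP: cm; move: m; apply: GF4_3_forall; vm_compute.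
by case/hasP=> a _ /and4P[*]; exists a, (m + scale4 a basis4_1).
Qed.

Section HyperovalInCoordinates.
Variables (F : finFieldType) (w : F).
Hypotheses (cardF : #|F| = 4%N) (hw : w ^+ 2 + w + 1 = 0).
Variables (conj : {rmorphism F -> F}) (conjE : forall a : F, conj a = a ^+ 2).
Variables (V : vectType F) (dimV : \dim {:V} = 3%N).
Variables (h : {hermitian_sym V for conj}) (hnd : nondegenerate h).
Variable H0 : {set {set finvect_type V}}.
Hypotheses (H0_hyperoval : hyperoval w H0) (H0_noniso : H0 \subset noniso_points w h).
Local Notation val4 := (val4 w).
Local Notation fV := (finvect_type V).
Local Notation pt := (pg_point w).

Lemma H0_unit p : p \in H0 -> exists2 x : fV, h x x = 1 & p = pt x.
Proof. by move=> /(subsetP H0_noniso)/imsetP[x]; rewrite inE => /eqP; exists x. Qed.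

Lemma unit_of_pt (x : fV) : pt x \in H0 -> h x x = 1.
Proof.
case/H0_unit=> y hy /(pg_point_mem hw)[a a0 ->].
by have := norm_scale cardF conjE h (y : V) a0; rewrite hy.
Qed.

Lemma dim_span2 (x y : V) : x != 0 -> (forall a, y != a *: x) ->
  \dim <<[:: y; x]>> = 2%N.
Proof.
move=> x0 nyx; suff /eqP -> : free [:: y; x] by [].
rewrite free_cons seq1_free x0 andbT span_seq1.
by apply/vlineP=> -[a yE]; have := nyx a; rewrite yE eqxx.
Qed.

Lemma span2P (x y z : V) : z \in <<[:: y; x]>>%VS -> exists a b, z = a *: y + b *: x.
Proof.
rewrite span_cons span_seq1 => /memv_addP[_ /vlineP[a ->] [_ /vlineP[b ->] ->]].
by exists a, b.
Qed.

Lemma unit_neq0 (x : V) : h x x = 1 -> x != 0.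
Proof. by apply: contra_eqN => /eqP->; rewrite linear0l eq_sym oner_neq0. Qed.

(** A unit vector a x + b y has norm a^3 + b^3 = 1, so exactly one of a and b is
zero: the line spanned by x and y contains no non-isotropic point besides x
and y, and H0 has a second point on it. *)
Lemma hyperoval_orthogonal (x y : fV) : h x x = 1 -> h y y = 1 -> h x y = 0 ->
  pt x \in H0 -> pt y \in H0.
Proof.
move=> hx hy hxy xH; pose U := <<[:: (y : V); (x : V)]>>%VS.
have hyx := herm_swap0 conjE hxy.
have dU : \dim U = 2%N.
  apply: dim_span2 (unit_neq0 hx) _ => a; apply: contraTneq (oner_neq0 F) => yE.
  by rewrite -hy {2}yE linearZr /= hyx mulr0 eqxx.
have xU : (x : V) \in U by rewrite memv_span // !inE eqxx orbT.
have [z [zH zU nzx]] := hyperoval_second H0_hyperoval dU xH xU.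
have [a [b zE]] := span2P zU.
have := unit_of_pt zH; rewrite zE linearDl !linearDr !linearZl !linearZr /=.
rewrite hx hy hxy hyx !mulr0 !mulr1 addr0 add0r !conjE => nab.
have cube (c : F) : c != 0 -> c * c ^+ 2 = 1.
  by move=> c0; apply: (mulfI c0); rewrite mulr1 -!exprS -[in LHS]cardF expf_card.
case: (eqVneq a 0) zE nab => [-> zE _ | a0 zE].
  rewrite scale0r add0r in zE.
  case/eqP: nzx; rewrite zE; apply: pg_point_scale => //.
  apply: contraTneq (unit_neq0 (unit_of_pt zH)) => b0.
  by rewrite zE b0 scale0r eqxx.
case: (eqVneq b 0) zE => [-> zE _ | b0 _].
  by move: zH; rewrite zE scale0r addr0 pg_point_scale.
by rewrite !cube // (add_self4 cardF) => /eqP; rewrite eq_sym oner_eq0.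
Qed.

Lemma vec1 (e1 e2 e3 : V) : vec w e1 e2 e3 basis4_1 = e1.
Proof. by rewrite /vec /val4 /= !mul0r !addr0 !scale0r !addr0 scale1r. Qed.

Lemma vec2 (e1 e2 e3 : V) : vec w e1 e2 e3 basis4_2 = e2.
Proof. by rewrite /vec /val4 /= !mul0r !addr0 !scale0r !addr0 add0r scale1r. Qed.

Lemma vec3 (e1 e2 e3 : V) : vec w e1 e2 e3 basis4_3 = e3.
Proof. by rewrite /vec /val4 /= !mul0r !addr0 !scale0r !add0r scale1r. Qed.

Lemma vec_ones (e1 e2 e3 : V) : vec w e1 e2 e3 ones4 = e1 + e2 + e3.
Proof. by rewrite /vec /val4 /= !mul0r !addr0 !scale1r. Qed.

Lemma pt_pg4 (e1 e2 e3 : V) m n : n \in pg4 m ->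
  pt (vec w e1 e2 e3 n) = pt (vec w e1 e2 e3 m).
Proof.
rewrite !inE => /or3P[] /eqP-> //; rewrite vec_scale //;
  by apply: pg_point_scale; rewrite // val4_eq0.
Qed.

Lemma pg4_pt (e1 e2 e3 : V) m n : frame h e1 e2 e3 ->
  (pt (vec w e1 e2 e3 n) == pt (vec w e1 e2 e3 m)) = (n \in pg4 m).
Proof.
move=> eF; apply/eqP/idP=> [E|]; last exact: pt_pg4.
have : vec w e1 e2 e3 n \in pt (vec w e1 e2 e3 m) by rewrite -E pg_point_refl.
have inj := inj_eq (vec_inj cardF hw conjE eF).
have s1 : w *: vec w e1 e2 e3 m = vec w e1 e2 e3 (scale4 w4 m).
  by rewrite vec_scale // val4_w.
have s2 : w ^+ 2 *: vec w e1 e2 e3 m = vec w e1 e2 e3 (scale4 (true, true) m).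
  by rewrite vec_scale // val4_w2.
by rewrite !inE -orbA s1 s2 !inj.
Qed.

Lemma frame_units (e1 e2 e3 : V) : frame h e1 e2 e3 -> pt e1 \in H0 ->
  pt e2 \in H0 /\ pt e3 \in H0.
Proof.
move=> [[h11 h22 h33] [h12 h13 _]] e1H.
by split; apply: (@hyperoval_orthogonal e1).
Qed.

(** The triangle of a point of H0 gives three of its six points.  A fourth one,
spanned by a unit vector x, has no zero coordinate with respect to this
triangle, and scaling each basis vector by a coordinate of x turns x into
e1 + e2 + e3. *)
Lemma exists_adapted_frame : exists e1 e2 e3 : V,
  [/\ frame h e1 e2 e3, pt e1 \in H0 & pt (e1 + e2 + e3 : V) \in H0].
Proof.
have [_ cH _] := H0_hyperoval.
have /card_gt0P[p pH] : (0 < #|H0|)%N by rewrite cH.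
have [e1 h11 pE] := H0_unit pH; rewrite {p}pE in pH.
have [e2 [e3 eF]] := exists_frame cardF hw conjE dimV hnd h11.
have [e2H e3H] := frame_units eF pH.
have : (0 < #|H0 :\: [set pt e1; pt e2; pt e3]|)%N.
  rewrite cardsD cH subn_gt0.
  apply: leq_ltn_trans (subset_leq_card (subsetIr _ _)) _.
  rewrite setUC cardsU1 cards2; by do 2!case: (_ == _) || case: (_ \notin _).
case/card_gt0P=> p; rewrite !inE !negb_or -!andbA => /and4P[n1 n2 n3 xH].
have [x hxx pE] := H0_unit xH; rewrite {p}pE in n1 n2 n3 xH.
have [g _ gK] := vec_bij cardF hw conjE dimV eF.
rewrite -(gK x) in n1 n2 n3 xH hxx; set m := g x in n1 n2 n3 xH hxx.
have um : unit4 m.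
  move: hxx; rewrite (herm_vec cardF hw conjE eF) => hm.
  rewrite /unit4; apply/eqP/(val4_inj cardF hw); rewrite hm.
  by rewrite /val4 /= mul0r addr0.
have pm : prod4 m != 0.
  apply: contraTN um => /eqP pm; apply/negP => um.
  have := unit4_prod0 um pm.
  rewrite -!(pg4_pt _ _ eF) vec1 vec2 vec3.
  by rewrite (negPf n1) (negPf n2) (negPf n3).
have [m1 m2 m3] : [/\ val4 m.1.1 != 0, val4 m.1.2 != 0 & val4 m.2 != 0].
  have z1 a : mul4 0 a = 0 by case: a => [[] []].
  have z2 a : mul4 a 0 = 0 by case: a => [[] []].
  by rewrite !val4_eq0 //; split; apply: contra pm => /eqP m0;
     rewrite /prod4 m0 ?(z1, z2).
exists (val4 m.1.1 *: e1), (val4 m.1.2 *: e2), (val4 m.2 *: e3); split=> //.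
- have [[h11' h22 h33] [h12 h13 h23]] := eF.
  split; split; rewrite ?norm_scale // linearZl linearZr /= ?h12 ?h13 ?h23;
  by rewrite ?mulr0.
- by rewrite pg_point_scale.
Qed.

Section AdaptedFrame.
Variables e1 e2 e3 : V.
Hypothesis eF : frame h e1 e2 e3.
Hypotheses (e1H : pt e1 \in H0) (onesH : pt (e1 + e2 + e3 : V) \in H0).
Local Notation vec := (vec w e1 e2 e3).

Lemma herm_unit4 m : (h (vec m) (vec m) == 1) = unit4 m.
Proof.
rewrite (herm_vec cardF hw conjE eF).
have -> : 1 = val4 (true, false) by rewrite /val4 /= mul0r addr0.
by rewrite (inj_eq (val4_inj cardF hw)).
Qed.

(** Orthogonality reaches all vectors with product 0 or 1 from the frame and from
e1 + e2 + e3.  A vector m with product w or w^2 is on a line with e1 and with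
such a vector n, so it would be a third point of H0 on that line. *)
Lemma mem_hyperoval_vec m : unit4 m -> (pt (vec m) \in H0) = ~~ (prod4 m).2.
Proof.
have oval n : oval4 n -> pt (vec n) \in H0.
  move=> on; have [e2H e3H] := frame_units eF e1H.
  have [[h11 h22 h33] [h12 h13 h23]] := eF.
  have un : h (vec n) (vec n) = 1 by apply/eqP; rewrite herm_unit4; case/andP: on.
  have orth k : unit4 k -> pt (vec k) \in H0 -> herm4 k n == 0 -> pt (vec n) \in H0.
    move=> uk kH /eqP kn; apply: hyperoval_orthogonal kH => //.
      by apply/eqP; rewrite herm_unit4.
    by rewrite (herm_vec cardF hw conjE eF) kn /val4 mul0r addr0.
  have [u1 u2 u3 u4] :
      [/\ unit4 basis4_1, unit4 basis4_2, unit4 basis4_3 & unit4 ones4].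
    by split; vm_compute.
  case/or3P: (oval4_cases on); [| |case/or3P].
  - by apply: (orth _ u1); rewrite vec1.
  - by apply: (orth _ u2); rewrite vec2.
  - by apply: (orth _ u3); rewrite vec3.
  - by apply: (orth _ u4); rewrite vec_ones.
  - by move/(pt_pg4 e1 e2 e3)->; rewrite vec_ones.
move=> um; case: (boolP (prod4 m).2) => [pm|npm]; last by apply: oval; rewrite /oval4 um.
apply/negP=> mH; have cm : coval4 m by rewrite /coval4 um pm.
have [a [n [nE on m1 n1 nm]]] := coval4_cases cm.
rewrite -!(pg4_pt _ _ eF) vec1 in m1 n1 nm.
pose U := <<[:: vec m : V; e1]>>%VS.
have mU : (vec m : V) \in U by rewrite memv_span // !inE eqxx.
have e1U : e1 \in U by rewrite memv_span // !inE eqxx orbT.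
have nU : (vec n : V) \in U.
  by rewrite nE vecD // vec_scale // vec1 rpredD // rpredZ.
have dU : \dim U = 2%N.
  have [[h11 _ _] _] := eF.
  apply: dim_span2 (unit_neq0 h11) _ => b; apply: contra m1 => /eqP mE.
  rewrite mE pg_point_scale //; apply: contraTneq um => b0.
  by rewrite -herm_unit4 mE b0 scale0r linear0l eq_sym oner_neq0.
apply: (hyperoval_no_three H0_hyperoval dU e1U mU nU) => //.
- exact: oval.
- by rewrite eq_sym.
- by rewrite eq_sym.
- by rewrite eq_sym.
Qed.

Lemma mem_V0_vec m : (vec m \in V0 h) = iso4 m.
Proof.
rewrite inE (herm_vec cardF hw conjE eF) val4_eq0 // /iso4; congr (~~ _ && _).
have v0 : vec 0 = 0 by apply: (addrI (vec 0)); rewrite -vecD // !addr0.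
by rewrite -[in LHS]v0 (inj_eq (vec_inj cardF hw conjE eF)).
Qed.

Lemma mem_oval_vec m : (vec m \in vectors_over w h H0) = oval4 m.
Proof.
rewrite !inE herm_unit4 /oval4; case um: (unit4 m) => //=.
exact: mem_hyperoval_vec.
Qed.

Lemma mem_coval_vec m :
  (vec m \in vectors_over w h (noniso_points w h :\: H0)) = coval4 m.
Proof.
rewrite inE in_setD inE herm_unit4 /coval4; case um: (unit4 m) => //=.
rewrite mem_hyperoval_vec // negbK andb_idr // => _.
by apply: imset_f; rewrite inE herm_unit4.
Qed.

End AdaptedFrame.

End HyperovalInCoordinates.

(** * The lines of S in coordinates *)
Section LinesInCoordinates.
Variables (F : finFieldType) (w : F).
Hypotheses (cardF : #|F| = 4%N) (hw : w ^+ 2 + w + 1 = 0).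
Variables (conj : {rmorphism F -> F}) (conjE : forall a : F, conj a = a ^+ 2).
Variables (V : vectType F) (dimV : \dim {:V} = 3%N).
Variables (h : {hermitian_sym V for conj}).
Variable H0 : {set {set finvect_type V}}.
Hypotheses (H0_hyperoval : hyperoval w H0) (H0_noniso : H0 \subset noniso_points w h).
Local Notation fV := (finvect_type V).
Variables e1 e2 e3 : V.
Hypothesis eF : frame h e1 e2 e3.
Hypotheses (e1H : pg_point w e1 \in H0) (onesH : pg_point w (e1 + e2 + e3 : V) \in H0).
Local Notation vec := (vec w e1 e2 e3).
Variable g : fV -> GF4_3.
Hypotheses (fK : cancel vec g) (gK : cancel g vec).
Local Notation col := (fun x y : fV => col4 (g x) (g y)).

Lemma pg_point_line m : pg_point w (vec m) = line (vec m) (vec (scale4 w4 m)).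
Proof.
rewrite /pg_point /line vec_scale // val4_w (w_sqr cardF hw).
by rewrite scalerDl scale1r.
Qed.

Lemma hline_line (W : {set fV}) (W4 : pred GF4_3) m n :
  (forall k, (vec k \in W) = W4 k) -> (W4 =1 oval4 \/ W4 =1 coval4) ->
  tangent4 W4 m n -> hline h W (vec m) = line (vec m) (vec n).
Proof.
move=> WE W4E tmn; have im : iso4 m by case/and4P: tmn.
have [n' _ tE] := tangent4_unique W4E im.
have {tE} tE k : tangent4 W4 m k = (k \in [:: n; m + n]).
  rewrite tE; move: tmn; rewrite tE !inE => /orP[] /eqP-> //.
  by rewrite addrA GF4_3_addxx add0r orbC.
apply/setP=> x; rewrite -(gK x); move: (g x) => k {x}.
rewrite in_line -!vecD // !(can_eq fK) in_setU in_set1 (can_eq fK) orbC.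
congr (_ || _).
have := tE k; rewrite !inE /tangent4 im /= => <-.
rewrite -vecD // !WE (herm_vec cardF hw conjE eF) val4_eq0 //.
Qed.

Lemma S_lines_col : S_lines w h H0 = lines col.
Proof.
have ovalE := mem_oval_vec cardF hw conjE H0_hyperoval H0_noniso eF e1H onesH.
have covalE := mem_coval_vec cardF hw conjE H0_hyperoval H0_noniso eF e1H onesH.
have V0E := mem_V0_vec cardF hw conjE eF.
have vD := @vecD _ w cardF V e1 e2 e3.
have HP := model_hexagonal_pencils fK gK vD.
have colP l : reflect (exists m n, col4 m n /\ l = line (vec m) (vec n)) (l \in lines col).
  apply: (iffP (linesP _ l)) => [[x [y [c ->]]]|[m [n [c ->]]]].
    by exists (g x), (g y); rewrite !gK.
  by exists (vec m), (vec n); rewrite !fK.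
have spreadE l : reflect (exists m n, spread_col4 m n /\ l = line (vec m) (vec n))
    (l \in [set pg_point w a | a in V0 h]).
  apply: (iffP imsetP) => [[a]|[m [n [c ->]]]].
    rewrite -(gK a) V0E => ia ->; exists (g a), (scale4 w4 (g a)).
    by rewrite /spread_col4 ia eqxx pg_point_line.
  case/orP: c => /andP[im /eqP->]; [exists (vec m) | exists (vec n)];
    by rewrite ?V0E // pg_point_line // line_sym.
have tangE (W : {set fV}) W4 l : (forall k, (vec k \in W) = W4 k) ->
    (W4 =1 oval4 \/ W4 =1 coval4) ->
    reflect (exists m n, tangent_col4 W4 m n /\ l = line (vec m) (vec n))
      (l \in [set hline h W a | a in V0 h]).
  move=> WE W4E; apply: (iffP imsetP) => [[a]|[m [n [c ->]]]].
    rewrite -(gK a) V0E => ia ->; have [n t _] := tangent4_unique W4E ia.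
    by exists (g a), n; rewrite (hline_line WE W4E t) /tangent_col4 t.
  have [a [b [t ->]]] : exists a b, tangent4 W4 a b /\
      line (vec m) (vec n) = line (vec a) (vec b).
    case/or3P: c => t; first by exists m, n.
      by exists n, m; rewrite line_sym.
    by exists (m + n), m; rewrite [RHS]line_sym vD (line_third HP).
  exists (vec a); last by rewrite (hline_line WE W4E t).
  by rewrite V0E; case/and4P: t.
have tang1 l := tangE _ _ l ovalE (or_introl (frefl _)).
have tang2 l := tangE _ _ l covalE (or_intror (frefl _)).
apply/setP=> l; rewrite /S_lines !in_setU.
apply/idP/colP => [|[m [n [/or3P[] c lE]]]].
- rewrite -orbA; case/or3P => [/spreadE|/tang1|/tang2] [m [n [c ->]]];
    by exists m, n; rewrite /col4 c ?orbT.
- by apply/orP; left; apply/orP; left; apply/spreadE; exists m, n.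
- by apply/orP; left; apply/orP; right; apply/tang1; exists m, n.
- by apply/orP; right; apply/tang2; exists m, n.
Qed.

End LinesInCoordinates.

(** * The quadric Q(6,2) and the split Cayley hexagon *)
Local Notation bit := (nth false).

Definition quad7 (s : seq bool) : bool :=
  (bit s 0 && bit s 4) (+) (bit s 1 && bit s 5) (+) (bit s 2 && bit s 6).

Definition grassmann7 (s t : seq bool) i j : bool :=
  (bit s i && bit t j) (+) (bit s j && bit t i).

Definition tits7 (s t : seq bool) : bool :=
  let p := grassmann7 s t in
  [&& p 1%N 2%N == p 3%N 4%N, p 4%N 5%N == p 2%N 3%N,
      p 0%N 2%N == p 3%N 5%N, p 5%N 6%N == p 0%N 3%N,
      p 0%N 1%N == p 3%N 6%N & p 4%N 6%N == p 1%N 3%N].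

Definition xor7 (s t : seq bool) : seq bool := [seq p.1 (+) p.2 | p <- zip s t].

Definition row7 (s : seq bool) : 'rV['F_2]_7 := \row_(i < 7) (bit s i)%:R.

Lemma F2_natrb (x : 'F_2) : x = (x == 1)%:R.
Proof. by case: x => [[|[|//]] i]; apply: val_inj. Qed.

Lemma natr_addb_F2 (b c : bool) : (b (+) c)%:R = b%:R + c%:R :> 'F_2.
Proof. exact: natr_addb (pchar_Fp (isT : prime 2)). Qed.

Lemma natr_eqb_F2 (b c : bool) : (b%:R == c%:R :> 'F_2) = (b == c).
Proof. by move: b c => [] []. Qed.

Lemma crd_row7 s i : (i < 7)%N -> crd (row7 s) i = (bit s i)%:R.
Proof. by move=> lti; rewrite /crd mxE /= modn_small. Qed.

Lemma row7D s t : size s = 7%N -> size t = 7%N -> row7 s + row7 t = row7 (xor7 s t).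
Proof.
move=> ss st; apply/rowP=> i; rewrite !mxE.
by rewrite (nth_map (false, false)) ?nth_zip ?size_zip ?ss ?st //= natr_addb_F2.
Qed.

Lemma row7_inj s t : size s = 7%N -> size t = 7%N -> row7 s = row7 t -> s = t.
Proof.
move=> ss st E; apply: (eq_from_nth (x0 := false)); rewrite ss ?st // => i lti.
by apply/eqP; rewrite -natr_eqb_F2 -!crd_row7 // E.
Qed.

Lemma mem_Q62_row7 s : (row7 s \in Q62) = (row7 s != 0) && (quad7 s == bit s 3).
Proof.
rewrite inE; congr (_ && _); rewrite !crd_row7 // -!natr_andb -!natr_addb_F2.
by rewrite expr2 -natr_andb andbb natr_eqb_F2.
Qed.

Lemma tits_line_row7 s t : tits_line (row7 s) (row7 t) = tits7 s t.
Proof.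
by rewrite /tits_line /grassmann !crd_row7 // -!natr_andb -!natr_addb_F2 !natr_eqb_F2.
Qed.

Lemma row7_onto v : exists2 s, size s = 7%N & v = row7 s.
Proof.
exists [seq crd v i == 1 | i <- iota 0 7]; first by [].
apply/rowP=> i; rewrite mxE (nth_map 0%N) ?size_iota // nth_iota // add0n -F2_natrb.
by rewrite /crd; congr (v _ _); apply: val_inj; rewrite /= modn_small.
Qed.

(** The six linear coordinates form an F_2-linear isometry from the trace form of
the Hermitian form to the polar form of X0X4 + X1X5 + X2X6, chosen among those
that send the lines of the explicit geometry to lines of the hexagon. The bit
at index 3 does not enter the quadratic form, so it can be filled in last. *)
Definition cayley_coords (m : GF4_3) : seq bool :=
  let a1 := m.1.1.1 in let b1 := m.1.1.2 in
  let a2 := m.1.2.1 in let b2 := m.1.2.2 in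
  let a3 := m.2.1 in let b3 := m.2.2 in
  let s q := [:: b2 (+) a3 (+) b3; a2 (+) a3; b1; q; b2 (+) b3; a2 (+) b2 (+) a3; a1] in
  s (quad7 (s false)).

Definition of_cayley_coords (s : seq bool) : GF4_3 :=
  let a3 := bit s 0 (+) bit s 4 in let b2 := bit s 1 (+) bit s 5 in
  ((bit s 6, bit s 2), (bit s 1 (+) a3, b2), (a3, bit s 4 (+) b2)).

Lemma cayley_coordsK : cancel cayley_coords of_cayley_coords.
Proof. by move=> m; apply/eqP; move: m; apply: GF4_3_forall; vm_compute. Qed.

Lemma of_cayley_coordsK s : size s = 7%N -> quad7 s = bit s 3 ->
  cayley_coords (of_cayley_coords s) = s.
Proof.
case: s => [|s0 [|s1 [|s2 [|s3 [|s4 [|s5 [|s6 [|]]]]]]]] // _ /= <-.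
by move: s0 s1 s2 s4 s5 s6 => [] [] [] [] [] [].
Qed.

Lemma quad7_cayley m : quad7 (cayley_coords m) = bit (cayley_coords m) 3.
Proof. by []. Qed.

(** Three points of the quadric are in question: the last condition says that the
sum of the two points is on the quadric as well. *)
Lemma col4_cayley m n : m != 0 -> n != 0 -> m != n ->
  let s := cayley_coords m in let t := cayley_coords n in
  col4 m n = tits7 s t && (quad7 (xor7 s t) == bit (xor7 s t) 3).
Proof.
move=> m0 n0 nmn s t; apply/eqP.
have : all (fun m => all (fun n => if [&& m != 0, n != 0 & m != n] then
   let s := cayley_coords m in let t := cayley_coords n in
   col4 m n == tits7 s t && (quad7 (xor7 s t) == bit (xor7 s t) 3) else true) GF4_3s) GF4_3s.
  by vm_compute.
by move/GF4_3_forall2/(_ m n); rewrite m0 n0 nmn.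
Qed.

Lemma cayley_coordsD m n : col4 m n ->
  cayley_coords (m + n) = xor7 (cayley_coords m) (cayley_coords n).
Proof. by move=> c; apply/eqP; move: m n c; apply: all_nbrs4P; vm_compute. Qed.

Definition cayley (m : GF4_3) : 'rV['F_2]_7 := row7 (cayley_coords m).

Lemma cayley_inj : injective cayley.
Proof.
move=> m n /row7_inj E; rewrite -(cayley_coordsK m) E //.
exact: cayley_coordsK.
Qed.

Lemma cayley0 : cayley 0 = 0.
Proof. by apply/rowP=> i; rewrite !mxE; case: i => [[|[|[|[|[|[|[|//]]]]]]] i]. Qed.

Lemma mem_Q62_cayley m : (cayley m \in Q62) = (m != 0).
Proof.
by rewrite mem_Q62_row7 quad7_cayley eqxx andbT -cayley0 (inj_eq cayley_inj).
Qed.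

Lemma Q62_cayley v : v \in Q62 -> exists m, v = cayley m.
Proof.
have [s ss ->] := row7_onto v; rewrite mem_Q62_row7 => /andP[_ /eqP qs].
by exists (of_cayley_coords s); rewrite /cayley of_cayley_coordsK.
Qed.

Lemma cayleyD m n : col4 m n -> cayley (m + n) = cayley m + cayley n.
Proof. by move=> c; rewrite /cayley cayley_coordsD // row7D. Qed.

Lemma cayley_lineP l : reflect (exists m n, col4 m n /\ l = pg62_line (cayley m) (cayley n))
  (l \in split_cayley_lines).
Proof.
rewrite inE; apply: (iffP existsP) => [[x /existsP[y]]|[m [n [c ->]]]].
  case/and5P=> x0 y0 nxy /eqP-> /andP[lQ txy].
  have [xQ yQ sQ] : [/\ x \in Q62, y \in Q62 & x + y \in Q62].
    by split; apply: (subsetP lQ); rewrite !inE eqxx ?orbT.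
  have [m xE] := Q62_cayley xQ; have [n yE] := Q62_cayley yQ.
  subst x y; move: xQ yQ sQ txy nxy; rewrite !mem_Q62_cayley => m0 n0.
  rewrite row7D // mem_Q62_row7 tits_line_row7 =>  /andP[_ qs] ts.
  rewrite (inj_eq cayley_inj) => nmn; exists m, n; split=> //.
  by rewrite col4_cayley // ts.
have /and3P[m0 n0 nmn] := col4_neq c.
exists (cayley m); apply/existsP; exists (cayley n).
have nz k : (cayley k != 0) = (k != 0) by rewrite -cayley0 (inj_eq cayley_inj).
rewrite !nz m0 n0 (inj_eq cayley_inj) nmn eqxx /=; apply/andP; split.
  have /and3P[_ p0 _] := col4_neq (col4_third c).
  apply/subsetP=> v; rewrite /pg62_line !in_setU !in_set1 -orbA -cayleyD //.
  by case/or3P=> /eqP->; rewrite mem_Q62_cayley.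
by move: c; rewrite col4_cayley // tits_line_row7 => /andP[].
Qed.

Theorem theorem4p7
  (F : finFieldType) (cardF : #|F| = 4%N) (w : F) (hw : w ^+ 2 + w + 1 = 0)
  (conj : {rmorphism F -> F}) (conjE : forall a : F, conj a = a ^+ 2)
  (V : vectType F) (dimV : \dim {:V} = 3%N)
  (h : {hermitian_sym V for conj}) (hnd : nondegenerate h)
  (H0 : {set {set finvect_type V}})
  (H0_hyperoval : hyperoval w H0)
  (H0_noniso : H0 \subset noniso_points w h) :
  generalized_hexagon (S_points V) (S_lines w h H0) 2 2 /\
  geometry_isomorphic (S_points V) (S_lines w h H0) Q62 split_cayley_lines.
Proof.
have [e1 [e2 [e3 [eF e1H onesH]]]] :=
  exists_adapted_frame cardF hw conjE dimV hnd H0_hyperoval H0_noniso.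
have [g fK gK] := vec_bij cardF hw conjE dimV eF.
have vD := @vecD _ w cardF V e1 e2 e3.
have SE := S_lines_col cardF hw conjE H0_hyperoval H0_noniso eF e1H onesH fK gK.
have gI := can_inj gK.
have gD x y : g (x + y) = g x + g y by apply: (transport_add fK gK vD).
have g0 x : (g x != 0) = (x != 0) by apply: (transport_neq0 fK gK vD).
rewrite SE; split.
  exact: pencils_generalized_hexagon (model_hexagonal_pencils fK gK vD).
pose phi x := cayley (g x).
have phiI : injective phi by move=> x y /cayley_inj/gI.
exists phi, (fun l : {set finvect_type V} => phi @: l); split.
- split; first by move=> x y _ _; apply: phiI.
  apply/setP=> v; apply/imsetP/idP => [[x x0 ->]|vQ].
    by rewrite mem_Q62_cayley g0; rewrite inE in x0.
  have [m vE] := Q62_cayley vQ; exists (vec w e1 e2 e3 m); last by rewrite /phi fK.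
  by rewrite inE -g0 fK -mem_Q62_cayley -vE.
- split; first by move=> l l' _ _; apply: imset_inj.
  have lineE x y : col4 (g x) (g y) -> phi @: line x y = pg62_line (phi x) (phi y).
    by move=> c; rewrite /line !imsetU !imset_set1 /phi gD cayleyD.
  have HP := model_hexagonal_pencils fK gK vD.
  apply/setP=> l; apply/imsetP/cayley_lineP => [[_ /linesP[x [y [c ->]]] ->]|].
    by exists (g x), (g y); rewrite lineE.
  case=> m [n [c ->]]; exists (line (vec w e1 e2 e3 m) (vec w e1 e2 e3 n)).
    by apply/linesP; exists (vec w e1 e2 e3 m), (vec w e1 e2 e3 n); rewrite !fK.
  by rewrite lineE /phi !fK.
- by move=> x l _ _; apply: mem_imset.
Qed.
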